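(* Let $n\ge 2$. A function $\mathrm{z}:\mathcal{P}(\mathbb{Z}^n)\to\mathbb{R}^n$ is an $\mathrm{SL}_n(\mathbb{Z})$ and translation equivariant valuation if and only if $\mathrm{z}=\ell_1$.
   Context: $\mathcal{P}(\mathbb{Z}^n)$ is the set of lattice polytopes, i.e. convex hulls of finite non-empty subsets of $\mathbb{Z}^n$. A function $\mathrm{z}:\mathcal{P}(\mathbb{Z}^n)\to\mathbb{R}^n$ is a valuation if $\mathrm{z}(P)+\mathrm{z}(Q)=\mathrm{z}(P\cup Q)+\mathrm{z}(P\cap Q)$ whenever $P,Q,P\cup Q,P\cap Q\in\mathcal{P}(\mathbb{Z}^n)$ (with the convention $\mathrm{z}(\emptyset)=0$). $\mathrm{SL}_n(\mathbb{Z})$ is the group of integer $n\times n$ matrices of determinant $1$. $\mathrm{z}$ is $\mathrm{SL}_n(\mathbb{Z})$ equivariant if $\mathrm{z}(\phi P)=\phi\,\mathrm{z}(P)$ for all $\phi\in\mathrm{SL}_n(\mathbb{Z})$ and $P\in\mathcal{P}(\mathbb{Z}^n)$; it is translation equivariant if $\mathrm{z}(P+x)=\mathrm{z}(P)+x$ for all $x\in\mathbb{Z}^n$ and $P\in\mathcal{P}(\mathbb{Z}^n)$. Discrete Steiner point: for $P\in\mathcal{P}(\mathbb{Z}^n)$ let $\ell(P)=\sum_{x\in P\cap\mathbb{Z}^n}x$. By a theorem of McMullen, there are $\ell_i(P)\in\mathbb{Q}^n$, $i=1,\dots,n+1$, with $\ell(kP)=\sum_{i=1}^{n+1}\ell_i(P)k^i$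 for all $k\in\mathbb{N}$. The coefficient $\ell_1(P)$ of $k$ is the discrete Steiner point of $P$. *)

(* Defs.v *)
From HB Require Import structures.
From mathcomp Require Import all_boot all_order all_algebra.
From mathcomp Require Import all_classical all_reals all_analysis.

Set Implicit Arguments.
Unset Strict Implicit.
Unset Printing Implicit Defensive.

Import Order.TTheory GRing.Theory Num.Theory.
Local Open Scope classical_set_scope.
Local Open Scope ring_scope.

Definition int_mx (R : nzRingType) (p q : nat) (M : 'M[int]_(p, q)) :
  'M[R]_(p, q) := map_mx intr M.

Definition convex_hull (R : realType) (n : nat) (A : set 'cV[R]_n) :
  set 'cV[R]_n := smallest (@convex_set R 'cV[R]_n) A.

Definition is_lattice_polytope (R : realType) (n : nat) (P : set 'cV[R]_n) :=
  exists S : set 'cV[int]_n,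
    [/\ finite_set S, S !=set0 & P = convex_hull [set int_mx R x | x in S]].

Record latticePolytope (R : realType) (n : nat) := LatticePolytope {
  lp_set :> set 'cV[R]_n;
  lp_setP : is_lattice_polytope lp_set
}.

Lemma lp_set_inj (R : realType) (n : nat) : injective (@lp_set R n).
Proof.
move=> [A hA] [B hB] /= eAB; rewrite eAB in hA *.
by congr LatticePolytope; exact: Prop_irrelevance.
Qed.

Lemma convex_hull_affine (R : realType) (n : nat) (M : 'M[R]_n) (b : 'cV[R]_n)
    (A : set 'cV[R]_n) :
  [set M *m x + b | x in convex_hull A] =
  convex_hull [set M *m x + b | x in A].
Proof.
have fconv (x y : convex_lmodType 'cV[R]_n) (t : {i01 R}) :
    M *m (t%:num *: x + (1 - t%:num) *: y) + b =
    t%:num *: (M *m x + b) + (1 - t%:num) *: (M *m y + b).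
  rewrite mulmxDr -!scalemxAr !scalerDr addrACA; congr (_ + _).
  by rewrite -scalerDl addrC subrK scale1r.
apply/seteqP; split=> [_ [x Ax <-]|].
  move=> C [Cc AC] /=.
  have := Ax [set u | C (M *m u + b)]; apply; split.
    move=> u v t; rewrite !inE /= => Cu Cv.
    rewrite [X in C X](fconv u v t).
    by have := Cc (M *m u + b) (M *m v + b) t; rewrite !inE; apply.
  by move=> u Au; apply: AC; exists u.
apply: smallest_sub => [u v t|_ [x Ax <-]]; last first.
  by exists x => //; exact: sub_gen_smallest.
rewrite !inE => -[x Ax <-] [y Ay <-].
exists (t%:num *: x + (1 - t%:num) *: y); last exact: fconv.
move=> C CA; have := Ax C CA; have := Ay C CA.
case: CA => Cc _ Cy Cx; have := Cc x y t; rewrite !inE; exact.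
Qed.

Lemma is_lattice_polytope_affine (R : realType) (n : nat) (M : 'M[int]_n)
    (b : 'cV[int]_n) (P : set 'cV[R]_n) :
  is_lattice_polytope P ->
  is_lattice_polytope [set int_mx R M *m x + int_mx R b | x in P].
Proof.
move=> [S [fS S0 ->]]; exists [set M *m x + b | x in S]; split.
- exact: finite_image.
- by case: S0 => x Sx; exists (M *m x + b), x.
- rewrite convex_hull_affine; congr convex_hull.
  rewrite !image_comp; apply: eq_imagel => x _ /=.
  by rewrite /int_mx map_mxD map_mxM.
Qed.

Lemma is_lattice_polytope_lin (R : realType) (n : nat) (M : 'M[int]_n)
    (P : latticePolytope R n) :
  is_lattice_polytope [set int_mx R M *m x | x in P].
Proof.
have := is_lattice_polytope_affine M 0 (lp_setP P).
by congr is_lattice_polytope; apply: eq_imagel => x _; rewrite /int_mx map_mx0 addr0.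
Qed.

Lemma is_lattice_polytope_shift (R : realType) (n : nat) (b : 'cV[int]_n)
    (P : latticePolytope R n) :
  is_lattice_polytope [set x + int_mx R b | x in P].
Proof.
have := is_lattice_polytope_affine 1%:M b (lp_setP P).
by congr is_lattice_polytope; apply: eq_imagel => x _; rewrite /int_mx map_mx1 mul1mx.
Qed.

Definition lp_lin (R : realType) (n : nat) (M : 'M[int]_n)
  (P : latticePolytope R n) : latticePolytope R n :=
  LatticePolytope (is_lattice_polytope_lin M P).

Definition lp_shift (R : realType) (n : nat) (P : latticePolytope R n)
  (b : 'cV[int]_n) : latticePolytope R n :=
  LatticePolytope (is_lattice_polytope_shift b P).

(* A latticePolytope is nonempty, so the case of an empty intersection is
   stated separately, with the value of z on the empty set taken to be 0. *)
Definition valuation (R : realType) (n : nat)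
    (z : latticePolytope R n -> 'cV[R]_n) :=
  forall P Q U : latticePolytope R n, U = P `|` Q :> set 'cV[R]_n ->
    (forall I : latticePolytope R n, I = P `&` Q :> set 'cV[R]_n ->
       z P + z Q = z U + z I) /\
    (P `&` Q = set0 -> z P + z Q = z U).

Definition SL_equivariant (R : realType) (n : nat)
    (z : latticePolytope R n -> 'cV[R]_n) :=
  forall (M : 'M[int]_n) (P : latticePolytope R n), \det M = 1 ->
    z (lp_lin M P) = int_mx R M *m z P.

Definition translation_equivariant (R : realType) (n : nat)
    (z : latticePolytope R n -> 'cV[R]_n) :=
  forall (b : 'cV[int]_n) (P : latticePolytope R n),
    z (lp_shift P b) = z P + int_mx R b.

(* The index set is finite since P is bounded in all uses; on an unbounded P
   with infinitely many nonzero lattice points the sum would default to 0. *)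
Definition lattice_point_sum (R : realType) (n : nat) (P : set 'cV[R]_n) :
  'cV[int]_n := \sum_(x \in [set x : 'cV[int]_n | P (int_mx R x)]) x.

Definition dilate (R : realType) (n : nat) (k : nat) (P : set 'cV[R]_n) :
  set 'cV[R]_n := [set k%:R *: x | x in P].

Definition point_sum_coefficients (R : realType) (n : nat) (P : set 'cV[R]_n)
    (l : nat -> 'cV[rat]_n) :=
  forall k : nat, int_mx rat (lattice_point_sum (dilate k P)) =
    \sum_(1 <= i < n.+2) k%:R ^+ i *: l i.

(* By McMullen's theorem such coefficients exist for every lattice polytope P,
   and l 1, ..., l n.+1 are unique since the identity holds for all k, so that
   the choice below selects the only possible value; 0 is a dummy default. *)
Definition discrete_steiner_rat (R : realType) (n : nat) (P : set 'cV[R]_n) :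
  'cV[rat]_n :=
  xget 0 [set v | exists2 l, point_sum_coefficients P l & v = l 1%N].

Definition discrete_steiner (R : realType) (n : nat)
    (P : latticePolytope R n) : 'cV[R]_n :=
  map_mx ratr (discrete_steiner_rat P).

(* Main.v *)
Require Import Defs.
From HB Require Import structures.
From mathcomp Require Import all_boot all_order all_algebra finmap.
From mathcomp Require Import all_classical all_reals all_analysis.
From mathcomp Require Import perm ring lra zify.

(** Write W S for the value of a valuation on the convex hull of a finite
    nonempty set S of lattice points.  If the segment from a to q meets the
    hull of S, then the hulls of S with a and of S with q cover the hull of S
    with a and q, and they meet exactly in the hull of S ([real_hull_cut]).
    Hence W satisfies [cut_relation], and the reduction described next uses
    this relation only.

    The first step is inclusion-exclusion ([iter_diff_eq0]): the alternating
    sum of W over the sets S + I, I ranging over the subsets of A, vanishes as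
    soon as the hulls of A and S have a common rational point.  An affine
    dependence inside a set gives such a point, so W is determined by its
    values on affinely independent sets.  If the vertices of a lattice simplex
    do not generate the lattice of their affine span, then some lattice point
    has barycentric coordinates strictly between -1 and 1, and the dependence
    between this point and the vertices expresses W on the simplex through
    simplices with smaller Gram determinant.  Therefore, modulo any subgroup, W
    is controlled by its values on unimodular (saturated) simplices
    ([saturated_reduction], in the spirit of Betke and Kneser).

    This reduction is used three times.  Take W S to be the sequence of lattice
    point counts, or of lattice point sums, of the dilates of the hull of S, and
    take the polynomial sequences as the subgroup.  On a saturated simplex the
    lattice points of the k-th dilate are the weighted sums of the vertices with
    weights in nat of total k, so both sequences are visibly polynomial; this is
    the existence of the discrete Steiner point l_1.  Its valuation property and
    its SL_n(Z) equivariance are read off from the uniqueness of polynomial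
    coefficients, and its translation equivariance amounts to the constant
    coefficient of the counting polynomial, its value at k = 0, being 1.

    For the converse, the difference of z and l_1 is a translation invariant and
    SL_n(Z) equivariant valuation, and by the reduction with the zero subgroup it
    is enough that it vanishes on saturated simplices.  By the Smith normal form
    these are unimodular images of standard simplices, and the value on a
    standard simplex is fixed by shears, by a reflection in two coordinates and
    by the cyclic permutations of three vertices, which forces it to be 0
    ([std_simplex_zero]). *)

Set Implicit Arguments.
Unset Strict Implicit.
Unset Printing Implicit Defensive.

Import Order.TTheory GRing.Theory Num.Theory.
Local Open Scope fset_scope.
Local Open Scope ring_scope.

(** * Lattice points and the cones they span *)

Section Cone.
Variable n : nat.
Notation pt := 'cV[int]_n.
Implicit Types (x a q : pt) (s A : seq pt) (S T : {fset pt}).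

(** Lifting lattice points to height 1 turns affine relations into linear ones. *)
Definition homog x : 'cV[int]_(1 + n) := col_mx (const_mx 1) x.
Definition height (v : 'cV[int]_(1 + n)) : int := usubmx v 0 0.

(** The list t, with repetitions, stands for coefficients in nat.  A nonzero vector
    lying in the cones of s and of s', once divided by its height, is a common
    rational point of the two convex hulls. *)
Definition in_cone s (v : 'cV[int]_(1 + n)) :=
  exists2 t : seq pt, {subset t <= s} & v = \sum_(x <- t) homog x.

Lemma height_is_additive : {morph height : u v / u - v}.
Proof. by move=> u v; rewrite /height linearB !mxE. Qed.
HB.instance Definition _ :=
  GRing.isZmodMorphism.Build _ _ height height_is_additive.

Lemma heightZ c v : height (c *: v) = c * height v.
Proof. by rewrite /height linearZ mxE. Qed.

Lemma height_homog x : height (homog x) = 1.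
Proof. by rewrite /height /homog col_mxKu mxE. Qed.

Lemma homogK x : dsubmx (homog x) = x.
Proof. exact: col_mxKd. Qed.

Lemma homog_dsubmx v : height v = 1 -> v = homog (dsubmx v).
Proof.
move=> v1; rewrite -{1}(vsubmxK v) /homog; congr (col_mx _ _).
by apply/matrixP=> i j; rewrite !ord1 [RHS]mxE -v1.
Qed.

Lemma in_cone_height s v : in_cone s v -> 0 <= height v.
Proof.
move=> [t _ ->]; rewrite raddf_sum sumr_ge0 // => x _.
by rewrite /= height_homog.
Qed.

Lemma in_cone_height0 s v : in_cone s v -> height v = 0 -> v = 0.
Proof.
move=> [[|a t] _ ->]; rewrite ?big_nil // raddf_sum /=.
under eq_bigr do rewrite height_homog.
by rewrite big_const_seq iter_addr_0 count_predT natz.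
Qed.

Lemma in_cone0 s : in_cone s 0.
Proof. by exists [::]; rewrite ?big_nil. Qed.

Lemma in_coneD s u v : in_cone s u -> in_cone s v -> in_cone s (u + v).
Proof.
move=> [t ts ->] [t' t's ->]; exists (t ++ t'); last by rewrite big_cat.
by move=> x; rewrite mem_cat => /orP[/ts|/t's].
Qed.

Lemma in_coneMn s v k : in_cone s v -> in_cone s (v *+ k).
Proof.
move=> sv; elim: k => [|k IHk]; first exact: in_cone0.
by rewrite mulrS; apply: in_coneD.
Qed.

Lemma in_cone_sum s (I : finType) (P : pred I) (F : I -> 'cV[int]_(1 + n)) :
  (forall i, P i -> in_cone s (F i)) -> in_cone s (\sum_(i | P i) F i).
Proof.
by move=> sF; elim/big_ind: _ => //; [apply: in_cone0 | apply: in_coneD].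
Qed.

Lemma in_cone_mem s x : x \in s -> in_cone s (homog x).
Proof. by move=> sx; exists [:: x]; rewrite ?big_seq1 // => y /[1!inE]/eqP->. Qed.

Lemma in_coneS s s' v : {subset s <= s'} -> in_cone s v -> in_cone s' v.
Proof. by move=> ss' [t ts ->]; exists t => // x /ts/ss'. Qed.

Lemma in_cone_cons a s v : in_cone (a :: s) v ->
  exists (k : nat) u, in_cone s u /\ v = homog a *+ k + u.
Proof.
move=> [t ts ->]; rewrite (bigID (pred1 a)) /= -[X in _ + X]big_filter.
exists (count_mem a t), (\sum_(x <- [seq x <- t | x != a]) homog x); split.
  exists [seq x <- t | x != a] => // x; rewrite mem_filter => /andP[xa /ts].
  by rewrite inE (negPf xa).
congr (_ + _); rewrite (eq_bigr (fun=> homog a)) => [|x /eqP->] //.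
by rewrite big_const_seq iter_addr_0.
Qed.

Lemma in_cone_nil v : in_cone [::] v -> v = 0.
Proof.
move=> [[|x t] ts ->]; first by rewrite big_nil.
by have := ts x; rewrite mem_head => /(_ isT).
Qed.

End Cone.

Section InclusionExclusion.
Variables (n : nat) (V : zmodType).
Notation pt := 'cV[int]_n.
Implicit Types (x a q : pt) (A : seq pt) (S T : {fset pt}) (W : {fset pt} -> V).

(** The vector v certifies that the segment from a to q meets the hull of S: its
    multiple of height 1 is the lift of a common point. *)
Definition cut_relation W := forall S a q (j k : nat),
  let v := homog a *+ j + homog q *+ k in
  v != 0 -> in_cone S v -> W (a |` S) + W (q |` S) = W (a |` (q |` S)) + W S.

(** Expanded, this is the alternating sum of W (I `|` S) over the subsets I of A. *)
Fixpoint iter_diff W A S :=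
  if A is a :: A' then iter_diff W A' (a |` S) - iter_diff W A' S else W S.

(** Only values of W at supersets of S occur, and each of the four terms adds the
    same directions to them. *)
Lemma iter_diff_cut W A S a q :
  (forall T, S `<=` T -> W (a |` T) + W (q |` T) = W (a |` (q |` T)) + W T) ->
  iter_diff W A (a |` S) + iter_diff W A (q |` S) =
  iter_diff W A (a |` (q |` S)) + iter_diff W A S.
Proof.
elim: A S => [|b A IHA] S hS /=; first exact: hS.
rewrite addrACA -opprD [in RHS]addrACA -opprD IHA //.
rewrite !(fsetUCA [fset b]) IHA // => T bST; apply: hS.
exact: fsubset_trans (fsubsetUr _ _) bST.
Qed.

Lemma iter_diff_absorb W A S a :
  (forall T, S `<=` T -> W (a |` T) = W T) ->
  iter_diff W A (a |` S) = iter_diff W A S.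
Proof.
elim: A S => [|b A IHA] S hS /=; first exact: hS.
rewrite (fsetUCA [fset b]) !IHA // => T bST; apply: hS.
exact: fsubset_trans (fsubsetUr _ _) bST.
Qed.

(** Inclusion-exclusion.  Let a be the head of A and let c be the point of the hull
    of the tail lying on the line from a through the common point f.  Some lattice
    point q lies on this line beyond c.  Since c is between f and q, induction
    applies to the tail and the two sets q |` S and a |` (q |` S); since f is
    between a and q, the cut relation compares all four sets obtained from S by
    adding a, q, both or none, and the two remaining differences cancel. *)
Lemma iter_diff_eq0 W A S v : cut_relation W ->
  v != 0 -> in_cone A v -> in_cone S v -> iter_diff W A S = 0.
Proof.
move=> Wcut; elim: A S v => [|a A IHA] S v v0 Av Sv /=.
  by rewrite (in_cone_nil Av) eqxx in v0.
have [k [u [Au def_v]]] := in_cone_cons Av.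
apply/eqP; rewrite subr_eq0; apply/eqP.
have [k0|k_gt0] := posnP k.
  move: def_v; rewrite k0 mulr0n add0r => def_v; rewrite -def_v in Au.
  by rewrite !(IHA _ v) //; apply: in_coneS Sv; apply/fsubsetP/fsubsetUr.
have [u0|u_neq0] := eqVneq u 0.
  rewrite u0 addr0 in def_v.
  apply: iter_diff_absorb => T ST.
  have := Wcut T a a k 0%N; rewrite /= mulr0n addr0 -def_v.
  rewrite fsetUA fsetUid => /(_ v0 (in_coneS (fsubsetP ST) Sv)).
  by move/addrI.
have [m def_m] : exists m : nat, height u = m.+1%:Z.
  have := in_cone_height Au; case def_m: (height u) => [[|m]|//] _; last by exists m.
  by rewrite (in_cone_height0 Au def_m) eqxx in u_neq0.
(* u is m + 1 times the lift of c, so that q = a + (m + 1) (c - a) *)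
pose q := dsubmx (u - homog a *+ m).
have def_q : homog q = u - homog a *+ m.
  rewrite -homog_dsubmx // raddfB raddfMn /= def_m height_homog.
  by rewrite intS natz addrK.
have def_u : u = homog q + homog a *+ m by rewrite def_q subrK.
have /(@iter_diff_cut _ A) : forall T, S `<=` T ->
    W (a |` T) + W (q |` T) = W (a |` (q |` T)) + W T.
  move=> T ST.
  have def_v' : v = homog a *+ (k + m) + homog q *+ 1.
    by rewrite def_v {1}def_u mulrnDr mulr1n -addrA [homog q + _]addrC.
  apply: (Wcut _ _ _ (k + m)%N 1%N); rewrite -def_v' //; exact: in_coneS (fsubsetP ST) Sv.
have qSu : in_cone (q |` S) (u *+ (k + m)).
  have -> : u *+ (k + m) = v *+ m + homog q *+ k.
    rewrite def_v mulrnDl mulrnDr addrAC; congr (_ + _).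
    by rewrite {1}def_u mulrnDl addrC -!mulrnA mulnC.
  apply: in_coneD; apply: in_coneMn; last exact/in_cone_mem/fset1U1.
  by apply: in_coneS Sv; apply/fsubsetP/fsubsetUr.
have u'0 : u *+ (k + m) != 0.
  apply: contra_neq u_neq0 => /(congr1 (@height n)).
  rewrite raddfMn raddf0 /= => /eqP; rewrite mulrn_eq0 addn_eq0 eqn0Ngt k_gt0 /=.
  by move/eqP => /(in_cone_height0 Au).
have Au' : in_cone A (u *+ (k + m)) by apply: in_coneMn.
have aqSu := in_coneS (fsubsetP (fsubsetUr [fset a] _)) qSu.
by rewrite (IHA _ _ u'0 Au' qSu) (IHA _ _ u'0 Au' aqSu) addr0 add0r.
Qed.

Variable X : V -> Prop.
Hypotheses (X0 : X 0) (XB : forall u v, X u -> X v -> X (u - v)).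

Lemma iter_diff_mem W A S :
  (forall I, {subset I <= A} -> X (W (I `|` S))) -> X (iter_diff W A S).
Proof.
elim: A S => [|a A IHA] S hX /=; first by rewrite -[S]fset0U; apply: hX.
apply: XB; apply: IHA => I IA.
  rewrite fsetUCA fsetUA; apply: hX => x; rewrite !inE => /orP[->//|/IA ->].
  by rewrite orbT.
by apply: hX => x /IA; rewrite inE => ->; rewrite orbT.
Qed.

(** In the expansion of the iterated difference only the term of the whole of A can
    leave the subgroup X. *)
Lemma iter_diff_mod W A S T : uniq A -> T =i A ->
  (forall I, {subset I <= A} -> ~ {subset A <= I} -> X (W (I `|` S))) ->
  X (iter_diff W A S - W (T `|` S)).
Proof.
elim: A S T => [|a A IHA] S T /= => [_ T0 _|/andP[aA uA] TA hX].
  suff -> : T `|` S = S by rewrite subrr.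
  by apply/fsetP=> x; rewrite in_fsetU T0.
rewrite addrAC; apply: XB.
  have -> : T `|` S = (T `\ a) `|` (a |` S).
    apply/fsetP=> x; rewrite !inE; case: eqVneq => [->|] //=.
    by rewrite TA mem_head.
  apply: IHA => // [x|I IA nAI].
    rewrite !inE TA inE; case: eqVneq => [->|] //=.
    by rewrite (negPf aA).
  rewrite fsetUCA fsetUA.
  apply: hX => [x|sub]; first by rewrite !inE => /orP[->//|/IA ->]; rewrite orbT.
  apply: nAI => x Ax; have := sub x; rewrite !inE Ax orbT => /(_ isT).
  by case/orP => // /eqP xa; rewrite -xa Ax in aA.
apply: iter_diff_mem => I IA; apply: hX => [x /IA|/(_ a)].
  by rewrite inE => ->; rewrite orbT.
by rewrite mem_head => /(_ isT)/IA; apply/negP.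
Qed.

End InclusionExclusion.

(** * Gram determinants of lattice simplices *)

(** This is Cramer's rule for the identity matrix. *)
Lemma det_replace_col m (b : 'I_m) (c : 'I_m -> int) :
  \det (\matrix_(i, j) if j == b then c i else (i == j)%:R) = c b.
Proof.
rewrite (expand_det_col _ b).
under eq_bigr => i _.
  rewrite mxE eqxx; set A := (\matrix_(_, _) _).
  have -> : cofactor A i b = (\adj (1%:M : 'M[int]_m)) b i.
    rewrite mxE /cofactor; congr (_ * \det _).
    by apply/matrixP=> j k; rewrite !mxE eq_sym (negPf (neq_lift _ _)).
  have -> : \adj (1%:M : 'M[int]_m) = 1%:M.
    by rewrite -[LHS]mul1mx mul_mx_adj det1.
  rewrite mxE; over.
rewrite (bigD1 b) //= eqxx mulr1 big1 ?addr0 // => i /negPf ib.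
by rewrite eq_sym ib mulr0.
Qed.

Section Gram.
Variables (n m : nat).
Implicit Type f : 'I_m -> 'cV[int]_n.

Definition homog_mx f : 'M[int]_(1 + n, m) := \matrix_(i, j) homog (f j) i 0.

(** Up to a constant factor, the square of the volume of the cone over the simplex
    with vertices f; it is an integer, so descent on it terminates. *)
Definition gram f : int := \det ((homog_mx f)^T *m homog_mx f).

Lemma homog_mxE f i j : homog_mx f i j = homog (f j) i 0.
Proof. by rewrite mxE. Qed.

Lemma mul_homog_mx f (c : 'I_m -> int) :
  homog_mx f *m (\col_j c j) = \sum_j c j *: homog (f j).
Proof.
apply/matrixP=> i j; rewrite !ord1 mxE summxE; apply: eq_bigr => k _.
by rewrite !mxE mulrC.
Qed.

(** A kernel vector v of the Gram matrix satisfies |X v|^2 = 0 over the integers,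
    hence X v = 0. *)
Lemma gram_eq0 f : gram f = 0 ->
  exists c : 'I_m -> int, (exists i, c i != 0) /\ \sum_i c i *: homog (f i) = 0.
Proof.
move=> /eqP/det0P[v v0 vXX]; exists (fun i => v 0 i); split.
  apply/existsP; apply: contraNT v0; rewrite negb_exists => /forallP v0.
  by apply/eqP/rowP=> i; rewrite mxE; apply/eqP; rewrite -[_ == _]negbK.
rewrite -mul_homog_mx; set X := homog_mx f in vXX *.
have -> : \col_j v 0 j = v^T by apply/matrixP=> i j; rewrite !mxE ord1.
set r := X *m v^T.
have : r^T *m r = 0 by rewrite trmx_mul trmxK mulmxA -(mulmxA v) vXX mul0mx.
move=> /matrixP/(_ 0 0); rewrite !mxE => /eqP.
rewrite psumr_eq0 => [/allP r0|i _]; last by rewrite !mxE -expr2 sqr_ge0.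
apply/colP=> i; have := r0 i (mem_index_enum _).
by rewrite mxE mulf_eq0 orbb => /eqP ->; rewrite mxE.
Qed.

(** Replacing a column of X by a combination c of its columns multiplies X on the
    right by a matrix of determinant c b. *)
Lemma gram_replace f (b : 'I_m) x (N : int) (c : 'I_m -> int) :
  N *: homog x = \sum_i c i *: homog (f i) ->
  gram [eta f with b |-> x] * N ^+ 2 = c b ^+ 2 * gram f.
Proof.
move=> def_x; set f' : 'I_m -> 'cV[int]_n := [eta f with b |-> x].
pose E (e : 'I_m -> int) : 'M[int]_m :=
  \matrix_(i, j) if j == b then e i else (i == j)%:R.
have detE e : \det (E e) = e b by apply: det_replace_col.
have EE e i j : E e i j = if j == b then e i else (i == j)%:R by rewrite mxE.
have XE : homog_mx f' *m E (fun i => N * (i == b)%:R) = homog_mx f *m E c.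
  apply/matrixP=> i j; rewrite [LHS]mxE [RHS]mxE.
  under eq_bigr do rewrite homog_mxE EE.
  under [RHS]eq_bigr do rewrite homog_mxE EE.
  have [jb|jb] := eqVneq j b; last first.
    apply: eq_bigr => k _; have [->|kj] := eqVneq k j; last by rewrite /= !mulr0.
    by rewrite /f' /= (negPf jb).
  rewrite (bigD1 b) //= eqxx mulr1 big1 ?addr0 => [|k /negPf ->]; last first.
    by rewrite /= !mulr0.
  have /matrixP/(_ i 0) := def_x; rewrite /f' /= eqxx [LHS]mxE mulrC => ->.
  by rewrite summxE; apply: eq_bigr => k _; rewrite [LHS]mxE mulrC.
have : \det ((homog_mx f' *m E (fun i => N * (i == b)%:R))^T *m
             (homog_mx f' *m E (fun i => N * (i == b)%:R))) =
       \det ((homog_mx f *m E c)^T *m (homog_mx f *m E c)) by rewrite XE.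
rewrite !trmx_mul !mulmxA -![_ *m homog_mx _]mulmxA.
rewrite -![(E _)^T *m _ *m _]mulmxA ![\det (_ *m (_ *m _))]det_mulmx.
rewrite ![\det (_ *m E _)]det_mulmx !det_tr !detE eqxx mulr1.
move=> e; transitivity (N * (gram f' * N)); first by rewrite expr2; ring.
by rewrite [X in _ * (X * _)]/gram e /gram; ring.
Qed.

End Gram.

(** * Saturated simplices *)

Section Descent.
Variable n : nat.
Notation pt := 'cV[int]_n.

(** The lifted vertices form a basis of all lattice vectors of their span, that is,
    the simplex is unimodular; rational coefficients are written c i / N. *)
Definition saturated m (f : 'I_m -> pt) := forall (N : nat) (c : 'I_m -> int) u,
  (0 < N)%N -> u *+ N = \sum_i c i *: homog (f i) -> forall i, (N %| c i)%Z.

(** Repetitions in f are harmless: the arguments below use only upper bounds on the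
    cardinality. *)
Definition vertex_set m (f : 'I_m -> pt) (P : pred 'I_m) : {fset pt} :=
  [fset x in [seq f i | i <- enum P]].

Section VertexSet.
Variables (m : nat) (f : 'I_m -> pt).
Implicit Type P : pred 'I_m.

Lemma vertex_setP P x :
  reflect (exists2 i, P i & x = f i) (x \in vertex_set f P).
Proof.
rewrite inE; apply: (iffP mapP) => -[i Pi ->]; exists i => //.
  by rewrite mem_enum in Pi.
by rewrite mem_enum.
Qed.

Lemma mem_vertex_set P i : P i -> f i \in vertex_set f P.
Proof. by move=> Pi; apply/vertex_setP; exists i. Qed.

Lemma card_vertex_set P : (#|` vertex_set f P| <= #|P|)%N.
Proof.
rewrite card_fseq; apply: leq_trans (size_undup _) _.
by rewrite size_map -cardE.
Qed.

Lemma vertex_set_cone P (c : 'I_m -> int) : (forall i, P i -> 0 <= c i) ->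
  in_cone (vertex_set f P) (\sum_(i | P i) c i *: homog (f i)).
Proof.
move=> c_ge0; apply: in_cone_sum => i Pi.
rewrite -(gez0_abs (c_ge0 i Pi)) -natz scaler_nat.
exact/in_coneMn/in_cone_mem/mem_vertex_set.
Qed.

Lemma height_comb P (c : 'I_m -> int) :
  height (\sum_(i | P i) c i *: homog (f i)) = \sum_(i | P i) c i.
Proof.
by rewrite raddf_sum; apply: eq_bigr => i _; rewrite /= heightZ height_homog mulr1.
Qed.

End VertexSet.

Lemma subset_of_card (T : finType) (P : pred T) k : (k <= #|P|)%N ->
  exists K : {set T}, #|K| = k /\ {subset K <= P}.
Proof.
move=> kP; exists [set x in take k (enum P)]; split.
  by rewrite cardsE (card_uniqP (take_uniq _ (enum_uniq _))) size_takel // -cardE.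
by move=> x; rewrite inE => /mem_take; rewrite mem_enum.
Qed.

(** Reducing the coefficients of a lattice vector modulo N makes all of them lie in
    [0, N), with total a positive multiple s N; there are more than s nonzero ones,
    so N can be subtracted from s - 1 of them, which brings the vector to height 1. *)
Lemma not_saturated m (f : 'I_m -> pt) : ~ saturated f ->
  exists (N : int) (c : 'I_m -> int) x, [/\ N *: homog x = \sum_i c i *: homog (f i),
    \sum_i c i = N & forall i, `|c i| < N].
Proof.
move=> /existsNP[N] /existsNP[c] /existsNP[u] /not_implyP[N_gt0].
move=> /not_implyP[def_u] /existsNP[i0 ndvd].
have NZ : N%:Z != 0 by rewrite eqz_nat -lt0n.
pose r i := (c i %% N)%Z.
have r_ge0 i : 0 <= r i by apply: modz_ge0.
have r_ltN i : r i < N by apply: ltz_pmod; rewrite ltz_nat.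
pose u' := u - \sum_i (c i %/ N)%Z *: homog (f i).
have def_u' : N%:Z *: u' = \sum_i r i *: homog (f i).
  rewrite scalerBr scaler_sumr -{1}natz scaler_nat def_u -sumrB; apply: eq_bigr => i _.
  rewrite scalerA -scalerBl; congr (_ *: _).
  by rewrite {1}(divz_eq (c i) N) mulrC addrAC subrr add0r.
have hu' : N%:Z * height u' = \sum_i r i by rewrite -heightZ def_u' height_comb.
pose P := [pred i | 0 < r i].
have Pi0 : P i0.
  rewrite /= lt_neqAle r_ge0 andbT eq_sym; apply/negP => /eqP ri0.
  by apply: ndvd; apply/dvdz_mod0P.
have u'_gt0 : 0 < height u'.
  rewrite -(pmulr_rgt0 _ (_ : 0 < N%:Z)) ?ltz_nat // hu' (bigD1 i0) //=.
  by apply: ltr_wpDr => //; apply: sumr_ge0.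
have u'_lt : height u' < #|P|%:Z.
  rewrite -(ltr_pM2l (_ : 0 < N%:Z)) ?ltz_nat // hu'.
  rewrite -(natz #|P|) mulr_natr -sumr_const (bigID P) /= [X in _ + X]big1 ?addr0.
    by apply: ltr_sum => //; apply/hasP; exists i0; rewrite ?mem_index_enum.
  by move=> i; rewrite lt_neqAle r_ge0 andbT negbK => /eqP.
have [s def_s] : exists s : nat, height u' = s.+1%:Z.
  by case: (height u') u'_gt0 => [[|s]|] // _; exists s.
have /subset_of_card[K [cardK KP]] : (s <= #|P|)%N.
  by rewrite def_s ltz_nat in u'_lt; apply: ltnW; apply: ltn_trans u'_lt.
pose c' i := r i - N%:Z * (i \in K)%:R.
pose x := dsubmx (u' - \sum_(i in K) homog (f i)).
have def_x : homog x = u' - \sum_(i in K) homog (f i).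
  rewrite -homog_dsubmx // raddfB raddf_sum /=.
  under eq_bigr do rewrite height_homog.
  by rewrite sumr_const cardK def_s; lia.
have cx : N%:Z *: homog x = \sum_i c' i *: homog (f i).
  rewrite def_x scalerBr def_u' scaler_sumr [X in _ - X]big_mkcond -sumrB.
  apply: eq_bigr => i _; rewrite [RHS]scalerBl; case: (i \in K).
    by rewrite /= mulr1.
  by rewrite /= mulr0 scale0r.
exists N%:Z, c', x; split=> // [|i].
  by rewrite -(height_comb f) -cx heightZ height_homog mulr1.
have := r_ge0 i; have := r_ltN i; rewrite /c'.
case: (boolP (i \in K)) => [/KP|_]; last by lia.
rewrite inE /=; lia.
Qed.

End Descent.

(** * Reduction of valuations to saturated simplices *)

Section Reduction.
Variables (n : nat) (V : zmodType).
Notation pt := 'cV[int]_n.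
Variable W : {fset pt} -> V.
Hypothesis Wcut : cut_relation W.
Variable X : V -> Prop.
Hypotheses (X0 : X 0) (XB : forall u v, X u -> X v -> X (u - v)).

Lemma vertex_set_enum (S : {fset pt}) :
  exists f : 'I_(#|` S|) -> pt, S = vertex_set f predT.
Proof.
exists (fun i => nth 0 S i); apply/fsetP=> x; apply/idP/vertex_setP.
  move=> Sx; have lt_x : (index x S < #|` S|)%N by rewrite index_mem.
  by exists (Ordinal lt_x); rewrite //= nth_index.
by case=> i _ ->; apply: mem_nth.
Qed.

Lemma vertex_setU m (f : 'I_m -> pt) (P Q : pred 'I_m) :
  (forall i, P i || Q i) ->
  vertex_set f P `|` vertex_set f Q = vertex_set f predT.
Proof.
move=> PQ; apply/fsetP=> x; rewrite in_fsetU; apply/orP/vertex_setP.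
  by case=> /vertex_setP[i _ ->]; exists i.
move=> [i _ ->]; case/orP: (PQ i) => ?; [left | right];
  exact: mem_vertex_set.
Qed.

(** By inclusion-exclusion the top term of a vanishing alternating sum lies in X as
    soon as the other terms do. *)
Lemma union_in_subgroup (A S : {fset pt}) v : v != 0 -> in_cone A v -> in_cone S v ->
  (forall I, I `<=` A -> ~ A `<=` I -> X (W (I `|` S))) -> X (W (A `|` S)).
Proof.
move=> v0 Av Sv hX.
rewrite -[W _]opprK -sub0r; apply: XB => //.
rewrite -sub0r -(iter_diff_eq0 Wcut v0 Av Sv).
apply: (iter_diff_mod X0 XB (fset_uniq _)) => // I IA nAI.
by apply: hX => [|/fsubsetP//]; apply/fsubsetP.
Qed.

Section Step.
Variables (m : nat) (f : 'I_m -> pt).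
Hypothesis XW_lt : forall S, S != fset0 -> (#|` S| < m)%N -> X (W S).

(** Separating the signs of an affine dependence exhibits a common point of the hulls
    of two parts of the vertex set, and every other term of the alternating sum is
    a smaller set. *)
Lemma dependent_in_subgroup (c : 'I_m -> int) : (exists i, c i != 0) ->
  \sum_i c i *: homog (f i) = 0 -> X (W (vertex_set f predT)).
Proof.
move=> [i0 ci0] c0.
pose P := [pred i | 0 < c i]; pose Q := [pred i | ~~ P i].
pose v := \sum_(i | P i) c i *: homog (f i).
have vE : v = \sum_(i | Q i) (- c i) *: homog (f i).
  apply/eqP; rewrite -subr_eq0 -sumrN; apply/eqP.
  under [X in _ + X]eq_bigr do rewrite scaleNr opprK.
  by rewrite -[RHS]c0 [RHS](bigID P).
have hv : \sum_(i | P i) c i = \sum_(i | Q i) - c i.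
  by rewrite -!(height_comb f) -/v vE.
have v_neq0 : v != 0.
  apply: contraNneq ci0 => v0; have hv0 : \sum_(i | P i) c i = 0.
    by rewrite -(height_comb f) -/v v0 raddf0.
  have [Pi|] := boolP (P i0).
    move/eqP: hv0; rewrite psumr_eq0 => [/allP/(_ i0)|i /ltW//].
    by rewrite mem_index_enum Pi; apply.
  move: hv; rewrite hv0 => /esym/eqP; rewrite psumr_eq0 => [/allP/(_ i0)|i].
    by rewrite mem_index_enum /= oppr_eq0 => /(_ isT)/implyP; apply.
  by rewrite /= -leNgt oppr_ge0.
have Pv : in_cone (vertex_set f P) v by apply: vertex_set_cone => i /ltW.
have Qv : in_cone (vertex_set f Q) v.
  by rewrite vE; apply: vertex_set_cone => i; rewrite /= -leNgt oppr_ge0.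
rewrite -(@vertex_setU _ f P Q) => [|i]; last by rewrite /= orbN.
apply: (union_in_subgroup v_neq0 Pv Qv) => I IP nPI; apply: XW_lt.
  apply: contraNneq v_neq0 => /eqP; rewrite fsetU_eq0 => /andP[_ /eqP Q0].
  by rewrite Q0 in Qv; apply/eqP/in_cone_nil.
apply: leq_ltn_trans (leq_card_fsetU _ _) _.
have IltP : (#|` I| < #|` vertex_set f P|)%N.
  by apply: fproper_ltn_card; rewrite fproperE IP; apply/negP.
rewrite -[X in (_ < X)%N](card_ord m) -(cardC P).
rewrite -addSn leq_add // ?(leq_trans IltP) ?card_vertex_set //.
Qed.

(** Here x has barycentric coordinates c i / N, and the relation between x and the
    vertices is used twice.  Removing vertices with positive coefficient shows that
    the value at the set of all vertices together with x lies in X; removing x and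
    the vertices with negative coefficient then isolates the value at the vertices
    alone.  In all other terms some vertex b with c b != 0 is missing, so that they
    are subsets of the simplex in which x replaces b. *)
Lemma refined_in_subgroup (N : int) (c : 'I_m -> int) x :
  N *: homog x = \sum_i c i *: homog (f i) -> \sum_i c i = N -> 0 < N ->
  (forall (b : 'I_m) S, c b != 0 -> S != fset0 ->
     S `<=` vertex_set [eta f with b |-> x] predT -> X (W S)) ->
  X (W (vertex_set f predT)).
Proof.
move=> def_x sum_c N_gt0 XW_repl.
pose P := [pred i | 0 < c i]; pose P' := [pred i | ~~ P i].
pose Q := [pred i | c i < 0]; pose Q' := [pred i | ~~ Q i].
have c_gt0 : 0 < \sum_(i | P i) c i.
  apply: lt_le_trans N_gt0 _; rewrite -sum_c (bigID P) /= gerDl.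
  by apply: sumr_le0 => i; rewrite -leNgt.
have def_P : \sum_(i | P i) c i *: homog (f i) =
    N *: homog x + \sum_(i | P' i) (- c i) *: homog (f i).
  rewrite def_x [X in _ = X + _](bigID P) /= -addrA -big_split /= [X in _ + X]big1 ?addr0 //.
  by move=> i _; rewrite scaleNr subrr.
have def_Q : \sum_(i | Q' i) c i *: homog (f i) =
    N *: homog x + \sum_(i | Q i) (- c i) *: homog (f i).
  rewrite def_x [X in _ = X + _](bigID Q) /= addrAC -big_split /= [X in X + _]big1 ?add0r //.
  by move=> i _; rewrite scaleNr subrr.
have xN S : in_cone (x |` S) (N *: homog x).
  rewrite -(gez0_abs (ltW N_gt0)) -natz scaler_nat.
  exact/in_coneMn/in_cone_mem/fset1U1.
have sub_repl (b : 'I_m) S : (forall y, y \in S -> y = x \/ exists2 i, i != b & y = f i) ->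
    S `<=` vertex_set [eta f with b |-> x] predT.
  move=> hS; apply/fsubsetP=> y /hS[->|[i ib ->]]; apply/vertex_setP.
    by exists b; rewrite //= eqxx.
  by exists i; rewrite //= (negPf ib).
have missing (R : pred 'I_m) I : I `<=` vertex_set f R -> ~ vertex_set f R `<=` I ->
    exists b, R b /\ forall i, f i \in I -> i != b.
  move=> _ /negP/fsubsetPn[y /vertex_setP[b Rb ->] bI]; exists b; split=> // i iI.
  by apply: contraNneq bI => <-.
have XWfx : X (W (x |` vertex_set f predT)).
  rewrite -(@vertex_setU _ f P P') => [|i]; last by rewrite /= orbN.
  rewrite fsetUCA; apply: (@union_in_subgroup _ _ (\sum_(i | P i) c i *: homog (f i))).
  - apply: contraTneq c_gt0 => /(congr1 (@height n)).
    by rewrite height_comb raddf0 => ->; rewrite ltxx.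
  - by apply: vertex_set_cone => i /ltW.
  - rewrite def_P; apply: in_coneD; first exact: xN.
    apply: in_coneS (fsubsetP (fsubsetUr _ _)) _; apply: vertex_set_cone => i.
    by rewrite /= oppr_ge0 -leNgt.
  move=> I IP nPI; have [b [Pb Ib]] := missing _ _ IP nPI.
  apply: (XW_repl b); first by rewrite gt_eqF.
    by apply/fset0Pn; exists x; rewrite !inE eqxx orbT.
  apply: sub_repl => y; rewrite in_fsetU in_fset1U => /or3P[yI|/eqP->|]; last 1 first.
  - move=> /vertex_setP[i P'i ->]; right; exists i => //.
    by apply: contraNneq P'i => ->.
  - have /(fsubsetP IP)/vertex_setP[i _ y_i] := yI.
    by right; exists i => //; apply: Ib; rewrite -y_i.
  - by left.
have XWQ I : I `<=` vertex_set f Q -> X (W (I `|` (x |` vertex_set f Q'))).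
  move=> IQ; have [QI|nQI] := boolP (vertex_set f Q `<=` I).
    have -> : I = vertex_set f Q by apply/eqP; rewrite eqEfsubset IQ.
    by rewrite fsetUCA vertex_setU // => i; rewrite /= orbN.
  have [b [Qb Ib]] := missing _ _ IQ (negP nQI).
  apply: (XW_repl b); first by rewrite lt_eqF.
    by apply/fset0Pn; exists x; rewrite !inE eqxx orbT.
  apply: sub_repl => y; rewrite in_fsetU in_fset1U => /or3P[yI|/eqP->|]; last 1 first.
  - move=> /vertex_setP[i Q'i ->]; right; exists i => //.
    by apply: contraNneq Q'i => ->.
  - have /(fsubsetP IQ)/vertex_setP[i _ y_i] := yI.
    by right; exists i => //; apply: Ib; rewrite -y_i.
  - by left.
have h_Q' : 0 < \sum_(i | Q' i) c i.
  apply: lt_le_trans N_gt0 _; rewrite -sum_c (bigID Q) /= gerDr.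
  by apply: sumr_le0 => i /ltW.
have D0 : iter_diff W (x :: vertex_set f Q) (vertex_set f Q') = 0.
  apply: (iter_diff_eq0 Wcut (v := \sum_(i | Q' i) c i *: homog (f i))).
  - apply: contraTneq h_Q' => /(congr1 (@height n)).
    by rewrite height_comb raddf0 => ->; rewrite ltxx.
  - rewrite def_Q; apply: in_coneD.
      rewrite -(gez0_abs (ltW N_gt0)) -natz scaler_nat.
      by apply/in_coneMn/in_cone_mem; rewrite mem_head.
    apply: (in_coneS (s := vertex_set f Q)) => [y Qy|]; first by rewrite inE Qy orbT.
    by apply: vertex_set_cone => i; rewrite /= oppr_ge0 => /ltW.
  - by apply: vertex_set_cone => i; rewrite /= -leNgt.
move: D0 => /= /eqP; rewrite subr_eq0 => /eqP D0.
have XD : X (iter_diff W (vertex_set f Q) (vertex_set f Q')).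
  by rewrite -D0; apply: (iter_diff_mem XB) => // I IQ; apply/XWQ/fsubsetP.
rewrite -(@vertex_setU _ f Q Q') => [|i]; last by rewrite /= orbN.
set D := iter_diff W _ _ in XD.
rewrite -[W _](subKr D); apply: XB => //.
apply: (iter_diff_mod X0 XB (fset_uniq _)) => // I /fsubsetP IQ nQI.
have [b [Qb Ib]] := missing _ _ IQ (fun QI => nQI (fsubsetP QI)).
apply: (XW_repl b); first by rewrite lt_eqF.
  apply: contraTneq h_Q' => /eqP; rewrite fsetU_eq0 => /andP[_ /eqP Q'0].
  rewrite big_pred0 ?ltxx // => i; apply: contraTF isT => Q'i.
  by have := mem_vertex_set f Q'i; rewrite Q'0.
apply: sub_repl => y; rewrite in_fsetU => /orP[yI|].
  have /(fsubsetP IQ)/vertex_setP[i _ y_i] := yI.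
  by right; exists i => //; apply: Ib; rewrite -y_i.
move=> /vertex_setP[i Q'i ->]; right; exists i => //.
by apply: contraNneq Q'i => ->.
Qed.

End Step.

(** Induction on the cardinality and, for a given cardinality, on the Gram
    determinant, which decreases when a vertex is replaced by a point whose
    corresponding barycentric coordinate has absolute value less than 1. *)
Theorem saturated_reduction :
  (forall d (f : 'I_d.+1 -> pt), saturated f -> X (W (vertex_set f predT))) ->
  forall S, S != fset0 -> X (W S).
Proof.
move=> Xsat.
suff Xf m k (f : 'I_m -> pt) : (0 < m)%N -> (`|gram f| < k)%N ->
    X (W (vertex_set f predT)).
  move=> S S_neq0; have [f ->] := vertex_set_enum S.
  by apply: (Xf _ `|gram f|.+1); rewrite ?ltnSn ?cardfs_gt0.
elim/ltn_ind: m => m IHm in k f *.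
have XW_lt S : S != fset0 -> (#|` S| < m)%N -> X (W S).
  move=> S_neq0 ltSm; have [g ->] := vertex_set_enum S.
  by apply: (IHm _ ltSm `|gram g|.+1); rewrite ?ltnSn ?cardfs_gt0.
elim: k => // k IHk in f * => m_gt0 lt_fk.
have [/gram_eq0[c [c0 cf]]|gram_neq0] := eqVneq (gram f) 0.
  exact: (dependent_in_subgroup XW_lt) cf.
have [sat_f|/not_saturated[N [c [x [def_x sum_c lt_cN]]]]] := pselect (saturated f).
  by case: m => // m in f {IHm XW_lt IHk lt_fk gram_neq0} sat_f m_gt0 *; apply: Xsat.
have N_gt0 : 0 < N.
  exact: le_lt_trans (normr_ge0 _) (lt_cN (Ordinal m_gt0)).
apply: (refined_in_subgroup def_x) => // b S cb0 S_neq0 sub_S.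
have [ltSm|leSm] := ltnP #|` S| m; first exact: XW_lt.
have -> : S = vertex_set [eta f with b |-> x] predT.
  apply/eqP; rewrite eqEfcard sub_S (leq_trans (card_vertex_set _ _)) //.
  by rewrite cardT size_enum_ord.
apply: IHk => //; rewrite -ltnS; apply: leq_ltn_trans lt_fk.
have := gram_replace b def_x; have := lt_cN b.
rewrite -absz_gt0 in gram_neq0.
move: (gram _) => g' ltcN /(congr1 absz); rewrite !abszM => e.
have lt_cNn : (`|c b| < `|N|)%N by lia.
have lt_sq := ltn_mul lt_cNn lt_cNn; rewrite ltnNge; apply/negP => le_gg'.
suff : (`|g'| * (`|N| * `|N|) < `|g'| * (`|N| * `|N|))%N by rewrite ltnn.
rewrite {1}e mulnC; apply: leq_trans (leq_mul le_gg' (leqnn _)).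
by rewrite ltn_pmul2l.
Qed.

End Reduction.

(** * Cutting convex hulls *)

Local Open Scope classical_set_scope.
Local Open Scope ring_scope.

Section Convex.
Variables (R : realType) (n : nat).
Notation vec := 'cV[R]_n.
Implicit Types (C M : set vec) (a q : vec).

Lemma convex_setP C : @convex_set R vec C <->
  forall x y (t : R), 0 <= t -> t <= 1 -> C x -> C y -> C (t *: x + (1 - t) *: y).
Proof.
split=> [Cc x y t t0 t1 Cx Cy|Cc x y t]; last first.
  by rewrite !inE => Cx Cy; apply: Cc.
have := Cc x y (Itv01 t0 t1).
rewrite !inE => /(_ Cx Cy).
by [].
Qed.

Lemma convex_hull_convex (A : set vec) : @convex_set R vec (convex_hull A).
Proof.
apply/convex_setP => x y t t0 t1 Ax Ay D DA.
by have [/convex_setP Dc _] := DA; apply: Dc => //; [apply: Ax|apply: Ay].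
Qed.

Lemma convex3 C (x y z : vec) (r s t : R) : @convex_set R vec C ->
  0 <= r -> 0 <= s -> 0 <= t -> r + s + t = 1 -> C x -> C y -> C z ->
  C (r *: x + s *: y + t *: z).
Proof.
move=> /convex_setP Cc r0 s0 t0 rst Cx Cy Cz.
have [rs0|rs_neq0] := eqVneq (r + s) 0.
  have [-> -> ->] : [/\ r = 0, s = 0 & t = 1] by split; lra.
  by rewrite !scale0r scale1r !add0r.
have rs_gt0 : 0 < r + s by rewrite lt_neqAle eq_sym rs_neq0 addr_ge0.
have -> : r *: x + s *: y + t *: z =
    (r + s) *: ((r / (r + s)) *: x + (1 - r / (r + s)) *: y) + (1 - (r + s)) *: z.
  by apply/colP=> i; rewrite !mxE (_ : t = 1 - (r + s)); [field|lra].
apply: (Cc) => //; [lra|lra|apply: Cc => //].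
  by rewrite divr_ge0 // ltW.
by rewrite ler_pdivrMr // mul1r lerDl.
Qed.

(** The union of the segments from a to the points of M, which is the hull of M and
    a when M is convex and nonempty. *)
Definition cone_over a M : set vec :=
  [set x | exists2 m, M m & exists2 t, 0 <= t <= 1 & x = t *: a + (1 - t) *: m].

Lemma cone_over3 a M m1 m2 (r s t : R) : @convex_set R vec M ->
  M m1 -> M m2 -> 0 <= r -> 0 <= s -> 0 <= t -> r + s + t = 1 ->
  cone_over a M (r *: a + s *: m1 + t *: m2).
Proof.
move=> /convex_setP Mc M1 M2 r0 s0 t0 rst.
have [st0|st_neq0] := eqVneq (s + t) 0.
  have [-> -> ->] : [/\ r = 1, s = 0 & t = 0] by split; lra.
  by exists m1 => //; exists 1; rewrite ?ler01 ?lexx // !scale0r subrr scale0r !addr0.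
have st_gt0 : 0 < s + t by rewrite lt_neqAle eq_sym st_neq0 addr_ge0.
exists ((s / (s + t)) *: m1 + (1 - s / (s + t)) *: m2).
  apply: Mc => //; first by rewrite divr_ge0 // ltW.
  by rewrite ler_pdivrMr // mul1r lerDl.
exists r; first by apply/andP; split; lra.
by apply/colP=> i; rewrite !mxE (_ : r = 1 - (s + t)); [field|lra].
Qed.

Lemma cone_over_convex a M : @convex_set R vec M -> @convex_set R vec (cone_over a M).
Proof.
move=> Mc; apply/convex_setP => x y t t0 t1.
move=> [m1 M1 [r /andP[r0 r1] {x}->]] [m2 M2 [s /andP[s0 s1] {y}->]].
have -> : t *: (r *: a + (1 - r) *: m1) + (1 - t) *: (s *: a + (1 - s) *: m2) =
    (t * r + (1 - t) * s) *: a + (t * (1 - r)) *: m1 + ((1 - t) * (1 - s)) *: m2.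
  by apply/colP=> i; rewrite !mxE; ring.
by apply: cone_over3 => //; nra.
Qed.

Lemma convex_hull_setU1 a (A : set vec) : A !=set0 ->
  convex_hull (a |` A) = cone_over a (convex_hull A).
Proof.
move=> [x0 Ax0]; apply/seteqP; split=> [x|x [m Mm [t /andP[t0 t1] ->]]].
  apply; split; first exact/cone_over_convex/convex_hull_convex.
  move=> y [->|Ay].
    exists x0; first by move=> D [_]; apply.
    by exists 1; rewrite ?ler01 ?lexx // subrr scale0r scale1r addr0.
  exists y; first by move=> D [_]; apply.
  by exists 0; rewrite ?ler01 ?lexx // subr0 scale0r scale1r add0r.
move=> D [Dc aAD]; have /convex_setP := Dc; apply=> //; first by apply: aAD; left.
by apply: Mm; split=> // y Ay; apply: aAD; right.
Qed.

Lemma sub_cone_over a M : M `<=` cone_over a M.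
Proof.
move=> m Mm; exists m => //; exists 0; first by rewrite lexx ler01.
by rewrite scale0r add0r subr0 scale1r.
Qed.

Lemma cone_overS a M M' : M `<=` M' -> cone_over a M `<=` cone_over a M'.
Proof. by move=> MM' _ [m Mm [t t01 ->]]; exists m; [apply: MM'|exists t]. Qed.

Section Cut.
Variables (M : set vec) (a q : vec) (r : R).
Hypotheses (Mc : @convex_set R vec M) (r0 : 0 <= r) (r1 : r <= 1).
Hypothesis Mg : M (r *: a + (1 - r) *: q).

(** In a combination of a, q and m, trade as much as possible of the weights of a
    and q for the point of M on the segment between them: one of a and q disappears. *)
Lemma cone_over_cutU : cone_over a (cone_over q M) = cone_over a M `|` cone_over q M.
Proof.
apply/seteqP; split=> [_ [_ [m Mm [t /andP[t0 t1] ->]] [s /andP[s0 s1] ->]]|]; last first.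
  move=> x [|]; last exact: sub_cone_over.
  by apply: cone_overS; exact: sub_cone_over.
have [le_sr|lt_rs] := leP (s * (1 - r)) ((1 - s) * t * r).
  right; have [r_eq0|r_neq0] := eqVneq r 0.
    have -> : s = 0 by move: le_sr; rewrite r_eq0; lra.
    by exists m => //; exists t; rewrite ?t0 // scale0r add0r subr0 scale1r.
  have r_gt0 : 0 < r by rewrite lt_neqAle eq_sym r_neq0.
  have -> : s *: a + (1 - s) *: (t *: q + (1 - t) *: m) =
     (((1 - s) * t * r - s * (1 - r)) / r) *: q + (s / r) *: (r *: a + (1 - r) *: q)
       + ((1 - s) * (1 - t)) *: m.
    by apply/colP=> i; rewrite !mxE; field.
  apply: cone_over3 => //.
  - by rewrite divr_ge0 // subr_ge0.
  - by rewrite divr_ge0.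
  - by rewrite mulr_ge0 // subr_ge0.
  - by field.
left; have r_lt1 : 0 < 1 - r.
  rewrite lt_neqAle subr_ge0 r1 andbT; apply: contraTneq lt_rs => <-.
  by rewrite mulr0 -leNgt mulr_ge0 // mulr_ge0 // subr_ge0.
have r_neq1 : 1 - r != 0 by rewrite gt_eqF.
have -> : s *: a + (1 - s) *: (t *: q + (1 - t) *: m) =
   ((s * (1 - r) - (1 - s) * t * r) / (1 - r)) *: a
    + ((1 - s) * t / (1 - r)) *: (r *: a + (1 - r) *: q)
     + ((1 - s) * (1 - t)) *: m.
  by apply/colP=> i; rewrite !mxE; field.
apply: cone_over3 => //.
- by rewrite divr_ge0 ?ltW // subr_gt0.
- by rewrite divr_ge0 ?mulr_ge0 ?subr_ge0.
- by rewrite mulr_ge0 // subr_ge0.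
- by field.
Qed.

(** A point x outside M in both pieces would be separated from M by a functional
    positive at a and at q, hence on the whole segment.  The explicit form of this
    argument writes x as a combination of m, m' and the point of M on the segment. *)
Lemma cone_over_cutI : cone_over a M `&` cone_over q M = M.
Proof.
apply/seteqP; split=> [x|m Mm]; last by split; exact: sub_cone_over.
move=> [[m Mm [s /andP[s0 s1] xs]] [m' Mm' [t /andP[t0 t1] xt]]].
have [s_eq0|s_neq0] := eqVneq s 0.
  by rewrite xs s_eq0 scale0r add0r subr0 scale1r.
have [t_eq0|t_neq0] := eqVneq t 0.
  by rewrite xt t_eq0 scale0r add0r subr0 scale1r.
have s_gt0 : 0 < s by rewrite lt_neqAle eq_sym s_neq0.
have t_gt0 : 0 < t by rewrite lt_neqAle eq_sym t_neq0.
pose k := r * t + (1 - r) * s.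
have k_gt0 : 0 < k.
  rewrite /k; have [->|r_neq0] := eqVneq r 0; first by rewrite mul0r add0r subr0 mul1r.
  have r_gt0 : 0 < r by rewrite lt_neqAle eq_sym r_neq0.
  by apply: ltr_wpDr; [rewrite mulr_ge0 // subr_ge0 | rewrite mulr_gt0].
have k_neq0 : k != 0 by rewrite gt_eqF.
have -> : x = (s * t / k) *: (r *: a + (1 - r) *: q) + (r * t * (1 - s) / k) *: m
    + ((1 - r) * s * (1 - t) / k) *: m'.
  apply/colP=> i; rewrite !mxE.
  have /colP/(_ i) := xs; have /colP/(_ i) := xt; rewrite !mxE => xti xsi.
  apply: (mulIf k_neq0).
  have -> : x i 0 * k = r * t * x i 0 + (1 - r) * s * x i 0 by rewrite /k; ring.
  by rewrite {1}xsi xti; field.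
apply: convex3 => //; rewrite ?divr_ge0 ?mulr_ge0 ?subr_ge0 // ?ltW //.
by rewrite /k; field.
Qed.

End Cut.

Lemma convex_mean C (T : eqType) (h : T -> vec) (s : seq T) : @convex_set R vec C ->
  (0 < size s)%N -> {in s, forall u, C (h u)} ->
  C ((size s)%:R^-1 *: \sum_(x <- s) h x).
Proof.
move=> /convex_setP Cc; elim: s => // x s IHs _ Ch.
have Cx : C (h x) by apply: Ch; rewrite mem_head.
have [s0|s_gt0] := posnP (size s).
  by rewrite (size0nil s0) big_seq1 invr1 scale1r.
have {}IHs := IHs s_gt0 (fun y ys => Ch y (@mem_behead _ (x :: s) y ys)).
have s_neq0 : (size s)%:R != 0 :> R by rewrite pnatr_eq0 -lt0n.
have s1_neq0 : (size s)%:R + 1 != 0 :> R by rewrite natr1 pnatr_eq0.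
have -> : (size (x :: s))%:R^-1 *: (\sum_(y <- x :: s) h y) =
    (size (x :: s))%:R^-1 *: h x +
    (1 - (size (x :: s))%:R^-1) *: ((size s)%:R^-1 *: \sum_(y <- s) h y) :> vec.
  rewrite big_cons /= -natr1.
  by apply/colP=> i; rewrite !mxE; field; rewrite s_neq0 s1_neq0.
by apply: Cc => //; rewrite ?invr_ge0 // invf_le1 ?ler1n ?ltr0n.
Qed.

End Convex.

Section Hull.
Variables (R : realType) (n : nat).
Implicit Types (S : {fset 'cV[int]_n}) (a q : 'cV[int]_n).

Definition real_hull S : set 'cV[R]_n :=
  convex_hull [set int_mx R x | x in [set` S]].

Lemma real_hull_setU1 a S : S != fset0 ->
  real_hull (a |` S)%fset = cone_over (int_mx R a) (real_hull S).
Proof.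
case/fset0Pn=> x Sx; rewrite /real_hull -convex_hull_setU1; last first.
  by exists (int_mx R x), x.
congr convex_hull; apply/seteqP; split=> [_ [y /= + <-]|y].
  by rewrite in_fset1U => /orP[/eqP->|Sy]; [left|right; exists y].
case=> [->|[z /= Sz <-]].
  by exists a => //=; rewrite in_fset1U eqxx.
by exists z => //=; rewrite in_fset1U Sz orbT.
Qed.

Lemma real_hull_cut S a q (j k : nat) :
    let v := homog a *+ j + homog q *+ k in v != 0 -> in_cone S v ->
  real_hull (a |` (q |` S))%fset = real_hull (a |` S)%fset `|` real_hull (q |` S)%fset /\
  real_hull S = real_hull (a |` S)%fset `&` real_hull (q |` S)%fset.
Proof.
move=> v v_neq0 [t tS def_v].
have size_t : size t = (j + k)%N.
  have /(congr1 (@height n)) := def_v; rewrite raddf_sum /=.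
  under eq_bigr do rewrite height_homog.
  rewrite big_const_seq iter_addr_0 count_predT raddfD !raddfMn /= !height_homog.
  by rewrite -mulrnDr !natz => -[->].
have jk_gt0 : (0 < j + k)%N.
  rewrite lt0n; apply: contraNneq v_neq0 => /eqP; rewrite addn_eq0.
  by rewrite /v => /andP[/eqP-> /eqP->]; rewrite !mulr0n addr0.
have S_neq0 : S != fset0.
  move: size_t jk_gt0; case: t tS {def_v} => [_ <-//|x t /(_ x)].
  by rewrite mem_head => /(_ isT) Sx _ _; apply/fset0Pn; exists x.
have sum_t : \sum_(x <- t) x = a *+ j + q *+ k.
  have /(congr1 dsubmx) := def_v; rewrite /v linearD !linearMn /= !homogK => ->.
  by rewrite linear_sum; apply: eq_bigr => x _; rewrite /= homogK.
have hc : @convex_set R _ (real_hull S) by apply: convex_hull_convex.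
pose r : R := j%:R / (j + k)%:R.
have jkR : (j%:R + k%:R : R) != 0 by rewrite -natrD pnatr_eq0 -lt0n.
have Sg : real_hull S (r *: int_mx R a + (1 - r) *: int_mx R q).
  have -> : r *: int_mx R a + (1 - r) *: int_mx R q =
      (size t)%:R^-1 *: \sum_(x <- t) int_mx R x.
    rewrite size_t; have -> : \sum_(x <- t) int_mx R x = int_mx R a *+ j + int_mx R q *+ k.
      by rewrite -!raddfMn -raddfD -sum_t raddf_sum.
    by apply/colP=> i; rewrite !mxE !mulmxnE !mxE /r natrD; field.
  apply: convex_mean => // [|x /tS Sx D [_]]; first by rewrite size_t.
  by apply; exists x.
have r0 : 0 <= r by rewrite divr_ge0.
have r1 : r <= 1 by rewrite ler_pdivrMr ?ltr0n // mul1r ler_nat leq_addr.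
rewrite !real_hull_setU1 //; last by apply/fset0Pn; exists q; apply: fset1U1.
by split; [apply: cone_over_cutU Sg | rewrite (cone_over_cutI hc r0 r1 Sg)].
Qed.

End Hull.
Arguments real_hull R {n} S _.

(** * Lattice sums over dilates *)

Lemma int_mx_inj (R : numDomainType) p q : injective (@int_mx R p q).
Proof.
move=> A B /matrixP AB; apply/matrixP=> i j.
by have := AB i j; rewrite !mxE => /intr_inj.
Qed.

Section Saturated.
Variables (n m : nat) (f : 'I_m -> 'cV[int]_n).
Hypothesis sat_f : saturated f.

Lemma saturated_free (c : 'I_m -> int) :
  \sum_i c i *: homog (f i) = 0 -> forall i, c i = 0.
Proof.
move=> c0 i; have /dvdzP[e] : (`|c i|.+1 %| c i)%Z.
  by apply: (sat_f (u := 0)) => //; rewrite mul0rn c0.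
by case: e => [[|e]|e] ce; move: ce; lia.
Qed.

(** Dependent vectors are never saturated, as every N would divide the coefficients
    of a vanishing combination. *)
Lemma saturated_gram : gram f != 0.
Proof.
apply/eqP => /gram_eq0[c [[i /eqP ci0]]] /saturated_free c0; exact: ci0.
Qed.

Lemma saturated_dim : (m <= 1 + n)%N.
Proof.
pose X := int_mx rat (homog_mx f).
have : X^T *m X \in unitmx.
  rewrite unitmxE /X /int_mx map_trmx -map_mxM det_map_mx unitfE intr_eq0.
  exact: saturated_gram.
move=> /mxrank_unit rX.
by rewrite -{1}rX (leq_trans (mxrankM_maxr _ _)) // rank_leq_row.
Qed.

(** Real coefficients of a lattice vector are rational with denominator dividing the
    Gram determinant, by multiplication by the adjugate of the Gram matrix;
    saturation then makes them integers. *)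
Lemma saturated_real (R : realFieldType) (mu : 'I_m -> R) u :
  int_mx R u = \sum_i mu i *: int_mx R (homog (f i)) ->
  exists c : 'I_m -> int, forall i, mu i = (c i)%:~R.
Proof.
move=> def_u; pose G := (homog_mx f)^T *m homog_mx f.
have XuE : int_mx R (homog_mx f) *m (\col_j mu j) = int_mx R u.
  rewrite def_u; apply/matrixP=> i j; rewrite !ord1 mxE summxE.
  by apply: eq_bigr => k _; rewrite !mxE mulrC.
pose w := \adj G *m (homog_mx f)^T *m u.
have wE i : (w i 0)%:~R = (gram f)%:~R * mu i.
  have : int_mx R w = (gram f)%:~R *: (\col_j mu j).
    rewrite /w /int_mx !map_mxM -/(int_mx R u) -XuE mulmxA.
    rewrite -[_ *m _ *m map_mx _ (homog_mx f)]mulmxA.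
    by rewrite -!map_mxM mul_adj_mx map_scalar_mx mul_scalar_mx.
  by move=> /matrixP/(_ i 0); rewrite !mxE.
have g_neq0 := saturated_gram; pose N := (`|gram f| * `|gram f|)%N.
have NE : N%:R = (gram f)%:~R * (gram f)%:~R :> R.
  by rewrite -intrM pmulrn; congr (_ *~ _); rewrite /N; lia.
pose c i := gram f * w i 0.
have cE i : (c i)%:~R = N%:R * mu i by rewrite NE intrM wE mulrA.
have N_gt0 : (0 < N)%N by rewrite muln_gt0 !absz_gt0 andbb.
have uN : u *+ N = \sum_i c i *: homog (f i).
  apply: (@int_mx_inj R); rewrite /int_mx raddfMn raddf_sum /= -/(int_mx R u) def_u.
  rewrite -scaler_nat scaler_sumr; apply: eq_bigr => i _.
  by rewrite scalerA -cE map_mxZ.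
exists (fun i => (c i %/ N)%Z) => i.
have N0 : N%:R != 0 :> R by rewrite pnatr_eq0 -lt0n.
apply: (mulfI N0); rewrite -cE -{1}(divzK (sat_f N_gt0 uN i)).
by rewrite intrM mulrC.
Qed.

End Saturated.

Section LatticeSum.
Variables (R : realType) (n : nat).
Notation vec := 'cV[R]_n.
Notation pt := 'cV[int]_n.
Implicit Types (P Q : set vec) (S : {fset pt}).

Definition lattice_points P : set pt := [set x | P (int_mx R x)].
Definition lattice_sum (V : zmodType) (g : pt -> V) P : V :=
  \sum_(x \in lattice_points P) g x.

Lemma finite_box (B : nat) : finite_set [set x : pt | forall i, `|x i 0| <= B%:Z].
Proof.
pose h (t : {ffun 'I_n -> 'I_(B + B).+1}) : pt := \col_i ((t i : nat)%:Z - B%:Z).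
apply: (@sub_finite_set _ _ [set h t | t in setT]); last exact: finite_image.
move=> x xB; exists [ffun i => inord `|x i 0 + B%:Z|] => //.
apply/colP=> i; rewrite mxE ffunE inordK; have := xB i; lia.
Qed.

Lemma real_hull_bounded S : exists B : nat, forall x, real_hull R S x ->
  forall i, `|x i 0| <= B%:R.
Proof.
pose B := (\max_(x <- S) \max_i `|x i 0%R|)%N.
exists B => x /(_ [set y | forall i, `|y i 0| <= B%:R]); apply; split.
  apply/convex_setP => u v t t0 t1 uB vB i; rewrite !mxE.
  apply: le_trans (ler_normD _ _) _.
  rewrite !normrM (ger0_norm t0) (@ger0_norm _ (1 - t)) ?subr_ge0 //.
  have := uB i; have := vB i; nra.
move=> _ [y /= Sy <-] i; rewrite mxE -intr_norm -abszE -pmulrn ler_nat.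
apply: (@leq_trans (\max_i `|y i 0%R|)%N).
  exact: (@leq_bigmax _ (fun i => `|y i 0%R|)%N).
by rewrite /B; apply: leq_bigmax_seq.
Qed.

Lemma finite_lattice_points k S : finite_set (lattice_points (dilate k (real_hull R S))).
Proof.
have [B hB] := real_hull_bounded S.
apply: sub_finite_set (finite_box (k * B)) => x [y /hB yB xE] i.
move/matrixP/(_ i 0): xE; rewrite !mxE => xE.
rewrite -(ler_int R) intr_norm -xE normrM -pmulrn natrM ger0_norm //.
by rewrite ler_wpM2l.
Qed.

Lemma lattice_sumUI (V : zmodType) (g : pt -> V) P Q :
  finite_set (lattice_points P) -> finite_set (lattice_points Q) ->
  lattice_sum g P + lattice_sum g Q = lattice_sum g (P `|` Q) + lattice_sum g (P `&` Q).
Proof.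
move=> fP fQ; rewrite /lattice_sum.
rewrite [X in _ + X](fsbigID (lattice_points P)) //.
rewrite [X in _ = X + _](fsbigID (lattice_points P)); last first.
  apply: (sub_finite_set (B := lattice_points P `|` lattice_points Q)) => //.
  by rewrite finite_setU.
have -> : lattice_points (P `|` Q) `&` lattice_points P = lattice_points P.
  by apply/seteqP; split=> [x []|x Px]//; split=> //; left.
have -> : lattice_points (P `|` Q) `&` ~` lattice_points P =
    lattice_points Q `&` ~` lattice_points P.
  by apply/seteqP; split=> [x [[]]|x [Qx nPx]]//; split=> //; right.
have -> : lattice_points (P `&` Q) = lattice_points Q `&` lattice_points P.
  by apply/seteqP; split=> x [].
by rewrite addrA addrAC.
Qed.

Lemma dilate0 P : P !=set0 -> dilate 0 P = [set 0].
Proof.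
case=> x Px; apply/seteqP; split=> [_ [y _ <-]|_ ->]; first by rewrite scale0r.
by exists x; rewrite // scale0r.
Qed.

Lemma dilateU k P Q : dilate k (P `|` Q) = dilate k P `|` dilate k Q.
Proof. exact: image_setU. Qed.

Lemma dilateI k P Q : (0 < k)%N -> dilate k (P `&` Q) = dilate k P `&` dilate k Q.
Proof.
move=> k_gt0; apply/seteqP; split=> [_ [x [Px Qx] <-]|_ [[x Px <-] [y Qy /scalerI]]].
  by split; exists x.
by rewrite pnatr_eq0 -lt0n => /(_ k_gt0) yx; exists x => //; split=> //; rewrite -yx.
Qed.

(** For k = 0 all four dilates are the origin, which is why P and Q have to meet. *)
Lemma lattice_sum_dilateUI (V : zmodType) (g : pt -> V) k P Q :
  (forall k, finite_set (lattice_points (dilate k P))) ->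
  (forall k, finite_set (lattice_points (dilate k Q))) -> P `&` Q !=set0 ->
  lattice_sum g (dilate k P) + lattice_sum g (dilate k Q) =
  lattice_sum g (dilate k (P `|` Q)) + lattice_sum g (dilate k (P `&` Q)).
Proof.
move=> fP fQ [x PQx]; have [Px Qx] := PQx.
case: k => [|k]; last by rewrite dilateU dilateI //; apply: lattice_sumUI.
by rewrite !dilate0 //; exists x => //; left.
Qed.

Lemma real_hull_neq0 S : S != fset0 -> real_hull R S !=set0.
Proof. by case/fset0Pn=> x Sx; exists (int_mx R x) => D [_]; apply; exists x. Qed.

Lemma lattice_sum_cut (V : zmodType) (g : pt -> V) :
  cut_relation (fun S k => lattice_sum g (dilate k (real_hull R S))).
Proof.
move=> S a q j k v v0 Sv; apply/funext=> l.
have [SU SI] := real_hull_cut R v0 Sv.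
rewrite !fctE SU SI; apply: lattice_sum_dilateUI => [i|i|].
- exact: finite_lattice_points.
- exact: finite_lattice_points.
rewrite -SI; apply: real_hull_neq0.
by apply: contraNneq v0 => S0; rewrite S0 in Sv; apply/eqP/in_cone_nil.
Qed.

End LatticeSum.

(** * Lattice points of saturated simplices *)

Definition compositions d k : {set d.+1.-tuple 'I_k.+1} :=
  [set t : d.+1.-tuple 'I_k.+1 | (\sum_(i <- t) i == k)%N].

Lemma compositionsP d k (t : d.+1.-tuple 'I_k.+1) :
  (t \in compositions d k) = (\sum_i tnth t i == k)%N.
Proof. by rewrite inE big_tuple. Qed.

(** All parts have the same total, because exchanging two parts is a symmetry. *)
Lemma sum_part d k (i : 'I_d.+1) :
  (d.+1 * (\sum_(t in compositions d k) tnth t i) = k * 'C(d + k, d))%N.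
Proof.
have part_eq (j : 'I_d.+1) : (\sum_(t in compositions d k) tnth t j =
    \sum_(t in compositions d k) tnth t i)%N.
  pose swap (t : d.+1.-tuple 'I_k.+1) := [tuple tnth t (tperm i j l) | l < d.+1].
  have swapK : involutive swap.
    by move=> t; apply: eq_from_tnth => l; rewrite !tnth_mktuple tpermK.
  rewrite [RHS](reindex_inj (inv_inj swapK)).
  apply: eq_big => [t|t _]; last by rewrite tnth_mktuple tpermL.
  rewrite !compositionsP [in RHS](reindex_inj (@perm_inj _ (tperm i j))).
  by congr (_ == _); apply: eq_bigr => l _; rewrite tnth_mktuple tpermK.
transitivity (\sum_(t in compositions d k) \sum_j tnth t j)%N.
  rewrite exchange_big /= (eq_bigr _ (fun j _ => part_eq j)).
  by rewrite sum_nat_const card_ord.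
rewrite (eq_bigr (fun=> k)) => [|t]; last by rewrite compositionsP => /eqP.
by rewrite sum_nat_const card_ord_partitions mulnC.
Qed.

(** The recurrence is (d + 1) C(d + 1 + k, d + 1) = (d + 1 + k) C(d + k, d). *)
Lemma bin_poly d : exists p : {poly rat},
  (size p <= d.+1)%N /\ forall k, p.[k%:R] = 'C(d + k, d)%:R.
Proof.
elim: d => [|d [p [size_p pE]]].
  by exists 1; rewrite size_poly1; split=> // k; rewrite hornerC bin0.
exists (d.+1%:R^-1 *: (('X + d.+1%:R%:P) * p)); split=> [|k].
  apply: leq_trans (size_scale_leq _ _) _; apply: leq_trans (size_polyMleq _ _) _.
  by rewrite size_XaddC.
have d1_neq0 : d.+1%:R != 0 :> rat by rewrite pnatr_eq0.
apply: (mulfI d1_neq0); rewrite hornerZ mulVKf // hornerM hornerD hornerX hornerC pE.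
by rewrite -natrD -!natrM addnC -mul_bin_diag addSn.
Qed.

Lemma affine_comb (K : nzRingType) n m (l : 'I_m -> K) (v : 'I_m -> 'cV[K]_n) :
  \sum_i l i *: col_mx (const_mx 1) (v i) =
  col_mx (const_mx (\sum_i l i)) (\sum_i l i *: v i) :> 'cV_(1 + n).
Proof.
apply/colP=> i; rewrite summxE; case: (split_ordP i) => j ->.
  by rewrite col_mxEu mxE; apply: eq_bigr => k _; rewrite mxE col_mxEu mxE mulr1.
by rewrite col_mxEd summxE; apply: eq_bigr => k _; rewrite mxE col_mxEd [RHS]mxE.
Qed.

Section Simplex.
Variables (R : realType) (n d : nat) (f : 'I_d.+1 -> 'cV[int]_n).
Hypothesis sat_f : saturated f.
Notation simplex := (real_hull R (vertex_set f predT)).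

Definition weighted_vertex k (t : d.+1.-tuple 'I_k.+1) : 'cV[int]_n :=
  \sum_i f i *+ tnth t i.

Lemma simplex_barycentric x : simplex x ->
  exists l : 'I_d.+1 -> R, [/\ forall i, 0 <= l i, \sum_i l i = 1
    & x = \sum_i l i *: int_mx R (f i)].
Proof.
pose D : set 'cV[R]_n := [set x | exists l : 'I_d.+1 -> R,
  [/\ forall i, 0 <= l i, \sum_i l i = 1 & x = \sum_i l i *: int_mx R (f i)]].
move=> /(_ D); apply; split.
  apply/convex_setP => _ _ t t0 t1 [l [l0 l1 ->]] [l' [l'0 l'1 ->]].
  exists (fun i => t * l i + (1 - t) * l' i); split.
  - by move=> i; rewrite addr_ge0 // mulr_ge0 // subr_ge0.
  - by rewrite big_split /= -!mulr_sumr l1 l'1 !mulr1 addrC subrK.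
  rewrite !scaler_sumr -big_split; apply: eq_bigr => i _.
  by rewrite /= !scalerA -scalerDl.
move=> _ [_ /= /vertex_setP[j _ ->] <-]; exists (fun i => (i == j)%:R); split.
- by move=> i; rewrite ler0n.
- by rewrite (bigD1 j) //= eqxx big1 ?addr0 // => i /negPf ->.
- rewrite (bigD1 j) //= eqxx scale1r big1 ?addr0 // => i /negPf ->.
  by rewrite scale0r.
Qed.

(** Barycentric coordinates of a lattice point of the dilate, multiplied by k, are the
    coefficients of a lattice vector at height k, so they are integers.  Conversely
    a sum of k vertices is k times their mean. *)
Lemma lattice_points_simplex k :
  lattice_points (dilate k simplex) = @weighted_vertex k @` [set` compositions d k].
Proof.
apply/seteqP; split=> [x [m /simplex_barycentric[l [l0 l1 ->]] xE]|_ [t /= tk <-]].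
  have [|c cE] := @saturated_real _ _ _ sat_f R (fun i => k%:R * l i)
      (col_mx (const_mx k%:Z) x).
    under eq_bigr do rewrite /homog /int_mx map_col_mx map_const_mx.
    rewrite affine_comb -mulr_sumr l1 mulr1 /int_mx map_col_mx map_const_mx -[map_mx _ x]xE.
    by rewrite scaler_sumr; under eq_bigr do rewrite scalerA.
  have {}cE i : k%:R * l i = (c i)%:~R := cE i.
  have c_ge0 i : 0 <= c i by rewrite -(ler0z R) -cE mulr_ge0.
  have sum_c : (\sum_i `|c i| = k)%N.
    have kE : k%:R = \sum_i k%:R * l i by rewrite -mulr_sumr l1 mulr1.
    apply/eqP; rewrite -(eqr_nat R) natr_sum kE; apply/eqP.
    by apply: eq_bigr => i _; rewrite cE pmulrn gez0_abs.
  have tE i : tnth [tuple (inord `|c j| : 'I_k.+1) | j < d.+1] i = `|c i|%N :> nat.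
    rewrite tnth_mktuple inordK // ltnS -[X in (_ <= X)%N]sum_c.
    by rewrite (bigD1 i) //= leq_addr.
  exists [tuple inord `|c i| | i < d.+1].
    by rewrite /= compositionsP (eq_bigr _ (fun i _ => tE i)) sum_c.
  apply: (@int_mx_inj R); rewrite -xE scaler_sumr /int_mx raddf_sum.
  apply: eq_bigr => i _; rewrite scalerA cE /= tE raddfMn /=.
  by rewrite -scaler_nat pmulrn gez0_abs.
have [k0|k_gt0] := posnP k.
  have [|m mP] := @real_hull_neq0 R n (vertex_set f predT).
    by apply/fset0Pn; exists (f ord0); apply: mem_vertex_set.
  have kR0 : k%:R = 0 :> R by rewrite k0.
  exists m => //; rewrite kR0 scale0r /weighted_vertex big1 ?/int_mx ?map_mx0 // => i _.
  by have -> : (tnth t i : nat) = 0%N by have := ltn_ord (tnth t i); lia.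
pose s := flatten [seq nseq (tnth t i) i | i <- enum 'I_d.+1].
have sumE (M : nmodType) (h : 'I_d.+1 -> M) : \sum_(i <- s) h i = \sum_i h i *+ tnth t i.
  rewrite big_flatten big_map big_enum; apply: eq_bigr => i _.
  by rewrite big_nseq iter_addr_0.
have size_s : size s = k.
  move: tk; rewrite compositionsP => /eqP <-.
  rewrite -sum1_size (sumE nat (fun=> 1%N)); apply: eq_bigr => i _.
  exact: natn.
exists (k%:R^-1 *: \sum_(i <- s) int_mx R (f i)).
  rewrite -size_s; apply: convex_mean; rewrite ?size_s //.
    exact: convex_hull_convex.
  by move=> i _ D [_]; apply; exists (f i) => //; apply: mem_vertex_set.
rewrite scalerA divff ?pnatr_eq0 -?lt0n // scale1r sumE.
by rewrite /int_mx raddf_sum; apply: eq_bigr => i _; rewrite raddfMn.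
Qed.

Lemma weighted_vertex_inj k : {in compositions d k &, injective (@weighted_vertex k)}.
Proof.
move=> t t'; rewrite !compositionsP => /eqP tk /eqP t'k tt'.
have /(saturated_free sat_f) t0 : \sum_i ((tnth t i)%:Z - (tnth t' i)%:Z) *: homog (f i) = 0.
  rewrite affine_comb.
  have -> : \sum_i ((tnth t i)%:Z - (tnth t' i)%:Z) = 0.
    rewrite sumrB; under eq_bigr do rewrite -natz.
    under [X in _ - X]eq_bigr do rewrite -natz.
    by rewrite -!natr_sum tk t'k subrr.
  have -> : \sum_i ((tnth t i)%:Z - (tnth t' i)%:Z) *: f i = 0.
    under eq_bigr do rewrite scalerBl -!natz !scaler_nat.
    by rewrite sumrB; apply/eqP; rewrite subr_eq0; apply/eqP.
  exact: col_mx0.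
by apply: eq_from_tnth => i; apply: val_inj; have /= := t0 i; lia.
Qed.

Lemma lattice_sum_simplex (V : zmodType) (g : 'cV[int]_n -> V) k :
  lattice_sum g (dilate k simplex) =
  \sum_(t in compositions d k) g (weighted_vertex t).
Proof.
rewrite /lattice_sum lattice_points_simplex fsbig_image; last first.
  by move=> t t' /set_mem /= tk /set_mem /= t'k; apply: weighted_vertex_inj.
rewrite fsbig_finite // -[RHS]big_enum; apply: perm_big.
apply: uniq_perm; rewrite ?fset_uniq ?enum_uniq // => t.
by rewrite mem_enum in_fset_set // mem_setE.
Qed.

End Simplex.

(** * Ehrhart polynomials *)

Section PolySeq.
Variable M : lmodType rat.
Implicit Types F G : nat -> M.

(** Polynomial sequences with exponents in [a, b): a = 1 expresses a vanishing
    constant term. *)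
Definition poly_seq a b F := exists l : nat -> M,
  forall k, F k = \sum_(a <= i < b) k%:R ^+ i *: l i.

Lemma poly_seq0 a b : poly_seq a b 0.
Proof. by exists 0 => k; rewrite big1 // => i _; rewrite scaler0. Qed.

Lemma poly_seqB a b F G : poly_seq a b F -> poly_seq a b G -> poly_seq a b (F - G).
Proof.
move=> [l lE] [m mE]; exists (l - m) => k.
change (F k - G k = \sum_(a <= i < b) k%:R ^+ i *: (l i - m i)).
rewrite lE mE -sumrB; by apply: eq_bigr => i _; rewrite -scalerBr.
Qed.

Lemma poly_seq_horner a b (p : {poly rat}) (v : M) : (size p <= b)%N ->
  (forall i, (i < a)%N -> p`_i = 0) -> poly_seq a b (fun k => p.[k%:R] *: v).
Proof.
move=> size_p p0; exists (fun i => p`_i *: v) => k.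
rewrite (horner_coef_wide _ size_p) scaler_suml big_geq_mkord [RHS]big_mkcond /=.
apply: eq_bigr => i _; case: leqP => [_|/p0 ->]; first by rewrite scalerA mulrC.
by rewrite mul0r scale0r.
Qed.

End PolySeq.

Lemma poly_seq_unique n a b (l m : nat -> 'cV[rat]_n) :
  (forall k : nat, \sum_(a <= i < b) k%:R ^+ i *: l i = \sum_(a <= i < b) k%:R ^+ i *: m i) ->
  forall i, (a <= i < b)%N -> l i = m i.
Proof.
move=> lm i /andP[leai ltib]; apply/colP=> j; apply/eqP; rewrite -subr_eq0; apply/eqP.
pose p := \poly_(i < b) (if (a <= i)%N then l i j 0 - m i j 0 else 0).
suff /(congr1 (fun q : {poly rat} => q`_i)) : p = 0 by rewrite coef_poly ltib leai coef0.
apply/eqP; apply: contraT => p_neq0.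
pose rs : seq rat := [seq k%:R | k <- iota 0 (size p)].
have : (size rs < size p)%N.
  apply: max_poly_roots p_neq0 _ _.
    apply/allP=> _ /mapP[k _ ->]; rewrite /root horner_poly; apply/eqP.
    have /eqP := lm k; rewrite -subr_eq0 -sumrB => /eqP/colP/(_ j).
    rewrite big_geq_mkord summxE [RHS]mxE => lm0.
    rewrite -[RHS]lm0 [RHS]big_mkcond /=; apply: eq_bigr => i' _.
    by case: leqP => _; rewrite ?mul0r // !mxE -mulrBr mulrC.
  by rewrite map_inj_uniq ?iota_uniq // => x y /eqP; rewrite eqr_nat => /eqP.
by rewrite size_map size_iota ltnn.
Qed.

Section Ehrhart.
Variables (R : realType) (n : nat).
Implicit Types (S : {fset 'cV[int]_n}).

(** The count for a saturated d-simplex is C(d + k, d). *)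
Lemma lattice_count_poly S : S != fset0 ->
  poly_seq 0 n.+1 (fun k => lattice_sum (fun=> 1 : rat^o) (dilate k (real_hull R S))).
Proof.
move=> S_neq0.
apply: (saturated_reduction (@lattice_sum_cut R n _ _) (@poly_seq0 rat^o 0 n.+1)
  (@poly_seqB rat^o 0 n.+1) _ S_neq0) => d f sat_f.
have [p [size_p pE]] := bin_poly d.
have [] := @poly_seq_horner rat^o 0 n.+1 p 1 _ _ => // [|l lE].
  exact: leq_trans size_p (saturated_dim sat_f).
exists l => k; rewrite -lE (lattice_sum_simplex _ sat_f) sumr_const.
by rewrite card_ord_partitions pE scaler_nat.
Qed.

(** By symmetry each vertex of a saturated d-simplex gets the same total weight,
    which is k C(d + k, d) / (d + 1): a polynomial without constant term. *)
Lemma lattice_point_sum_poly S : S != fset0 ->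
  poly_seq 1 n.+2 (fun k => lattice_sum (@int_mx rat n 1) (dilate k (real_hull R S))).
Proof.
move=> S_neq0.
apply: (saturated_reduction (@lattice_sum_cut R n _ _) (@poly_seq0 _ 1 n.+2)
  (@poly_seqB _ 1 n.+2) _ S_neq0) => d f sat_f.
have [p [size_p pE]] := bin_poly d.
have [] := @poly_seq_horner _ 1 n.+2 ('X * p) (d.+1%:R^-1 *: \sum_i int_mx rat (f i)) _ _.
- apply: leq_trans (size_polyMleq _ _) _; rewrite size_polyX /= ltnS.
  exact: leq_trans size_p (saturated_dim sat_f).
- by case=> // _; rewrite coefXM.
move=> l lE; exists l => k; rewrite -lE (lattice_sum_simplex _ sat_f) hornerM hornerX pE.
rewrite /weighted_vertex; under eq_bigr do rewrite /int_mx raddf_sum.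
rewrite exchange_big scalerA scaler_sumr; apply: eq_bigr => i _ /=.
under eq_bigr do rewrite raddfMn.
rewrite sumrMnr -scaler_nat; congr (_ *: _).
rewrite -natrM -(sum_part k i) natrM mulrAC mulfV ?mul1r ?pnatr_eq0 //.
Qed.

End Ehrhart.

(** * The discrete Steiner point *)

Section Steiner.
Variables (R : realType) (n : nat).
Implicit Types (S : {fset 'cV[int]_n}) (P Q U : latticePolytope R n).

Lemma lattice_polytope_hull P : exists2 S, S != fset0 & P = real_hull R S :> set 'cV[R]_n.
Proof.
have [A [fA [x Ax] ->]] := lp_setP P.
exists (fset_set A); last by rewrite /real_hull fset_setK.
by apply/fset0Pn; exists x; rewrite in_fset_set // inE.
Qed.

Lemma polytope_neq0 P : (P : set _) !=set0.
Proof. by have [S S0 ->] := lattice_polytope_hull P; apply: real_hull_neq0. Qed.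

Lemma polytope_lattice_finite P k : finite_set (lattice_points (dilate k P)).
Proof. by have [S _ ->] := lattice_polytope_hull P; apply: finite_lattice_points. Qed.

Lemma lattice_sum_fset (V : zmodType) (g : 'cV[int]_n -> V) P k :
  lattice_sum g (dilate k P) = \sum_(x <- fset_set (lattice_points (dilate k P))) g x.
Proof. by rewrite /lattice_sum fsbig_finite //; apply: polytope_lattice_finite. Qed.

Lemma int_mx_point_sum P k :
  int_mx rat (lattice_point_sum (dilate k P)) = lattice_sum (@int_mx rat n 1) (dilate k P).
Proof.
rewrite lattice_sum_fset /lattice_point_sum fsbig_finite /int_mx ?raddf_sum //.
exact: polytope_lattice_finite.
Qed.

Lemma steiner_coefficients P : exists l, point_sum_coefficients P l.
Proof.
have [S S0 PE] := lattice_polytope_hull P.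
have [l lE] := lattice_point_sum_poly R S0; exists l => k.
by rewrite int_mx_point_sum PE lE.
Qed.

Lemma steiner_coefficientE P l : point_sum_coefficients P l ->
  discrete_steiner P = map_mx ratr (l 1%N).
Proof.
move=> lP; rewrite /discrete_steiner /discrete_steiner_rat; congr map_mx.
apply: xget_subset1; first by exists l.
move=> _ _ [l1 l1P ->] [l2 l2P ->].
by apply: (@poly_seq_unique _ 1 n.+2) => // k; rewrite -l1P -l2P.
Qed.

Lemma poly_sumD (M : lmodType rat) a b (x : rat) (l m : nat -> M) :
  \sum_(a <= i < b) x ^+ i *: (l i + m i) =
  \sum_(a <= i < b) x ^+ i *: l i + \sum_(a <= i < b) x ^+ i *: m i.
Proof. by rewrite -big_split; apply: eq_bigr => i _; rewrite scalerDr. Qed.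

(** The coefficient sequences of P and Q add up to those of the union and the
    intersection because the lattice sums do, for every k including 0. *)
Lemma discrete_steiner_valuation : valuation (@discrete_steiner R n).
Proof.
move=> P Q U UE; have [p pE] := steiner_coefficients P.
have [q qE] := steiner_coefficients Q; have [u uE] := steiner_coefficients U.
rewrite (steiner_coefficientE pE) (steiner_coefficientE qE) (steiner_coefficientE uE).
split=> [I IE|PQ0].
  have [i iE] := steiner_coefficients I; rewrite (steiner_coefficientE iE).
  rewrite -!map_mxD; congr map_mx.
  apply: (@poly_seq_unique _ 1 n.+2 (fun i => p i + q i) (fun j => u j + i j)) => // k.
  rewrite !poly_sumD -pE -qE -uE -iE !int_mx_point_sum UE IE.
  apply: lattice_sum_dilateUI => [j|j|]; try exact: polytope_lattice_finite.
  by rewrite -IE; apply: polytope_neq0.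
rewrite -!map_mxD; congr map_mx.
apply: (@poly_seq_unique _ 1 n.+2 (fun i => p i + q i) u) => // k.
rewrite poly_sumD -pE -qE -uE.
case: k => [|k].
  rewrite pE qE uE !big_nat !big1 ?addr0 // => j /andP[j_gt0 _];
  by rewrite expr0n gtn_eqF // scale0r.
rewrite !int_mx_point_sum UE dilateU.
rewrite lattice_sumUI; try exact: polytope_lattice_finite.
rewrite -dilateI // PQ0 -[RHS]addr0; congr (_ + _).
rewrite /lattice_sum (_ : lattice_points _ = set0) ?fsbig_set0 //.
by apply/seteqP; split=> x // [].
Qed.

Lemma lattice_sum_reindex (V : zmodType) (g : 'cV[int]_n -> V) (A B : set 'cV[R]_n)
    (h : 'cV[int]_n -> 'cV[int]_n) : injective h ->
  lattice_points B = h @` lattice_points A -> lattice_sum g B = lattice_sum (g \o h) A.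
Proof.
move=> h_inj BE; rewrite /lattice_sum BE fsbig_image // => x y _ _; exact: h_inj.
Qed.

Lemma discrete_steiner_SL : SL_equivariant (@discrete_steiner R n).
Proof.
move=> M P detM; have [p pE] := steiner_coefficients P.
have Mu : M \in unitmx by rewrite unitmxE detM unitr1.
rewrite (steiner_coefficientE pE).
rewrite (@steiner_coefficientE _ (fun i => int_mx rat M *m p i)); last first.
  move=> k; rewrite int_mx_point_sum.
  rewrite (@lattice_sum_reindex _ _ (dilate k P) _ (mulmx M)).
  - have -> : \sum_(1 <= i < n.+2) k%:R ^+ i *: (int_mx rat M *m p i) =
        int_mx rat M *m int_mx rat (lattice_point_sum (dilate k P)).
      by rewrite pE mulmx_sumr; apply: eq_bigr => i _; rewrite scalemxAr.
    rewrite int_mx_point_sum !lattice_sum_fset mulmx_sumr.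
    by apply: eq_bigr => x _; rewrite /= /int_mx map_mxM.
  - exact: (can_inj (mulKmx Mu)).
  apply/seteqP; split=> [x [_ [y Py <-] xE]|_ [x [y Py xE] <-]].
    exists (invmx M *m x); last by rewrite mulKVmx.
    exists y => //; rewrite /int_mx map_mxM -/(int_mx R x) -xE -scalemxAr mulmxA.
    by rewrite -map_mxM mulVmx // map_mx1 mul1mx.
  exists (int_mx R M *m y); first by exists y.
  by rewrite /int_mx map_mxM -/(int_mx R x) -xE -scalemxAr.
rewrite map_mxM; congr (_ *m _); rewrite /int_mx -map_mx_comp; apply: eq_map_mx => x.
by rewrite /= ratr_int.
Qed.

Lemma lattice_count0 P : lattice_sum (fun=> 1 : rat^o) (dilate 0 P) = 1.
Proof.
rewrite dilate0; last exact: polytope_neq0.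
rewrite /lattice_sum (_ : lattice_points _ = [set 0]) ?fsbig_set1 //.
apply/seteqP; split=> [x|_ ->]; last by rewrite /lattice_points /= /int_mx map_mx0.
by rewrite /lattice_points /= -(map_mx0 (intr : int -> R)) => /int_mx_inj.
Qed.

(** Translating by b adds k L(k) b to the lattice sum of the k-th dilate, where L is
    the counting polynomial, so the coefficient of k grows by L(0) b = b. *)
Lemma discrete_steiner_translation : translation_equivariant (@discrete_steiner R n).
Proof.
move=> b P; have [p pE] := steiner_coefficients P.
have [S S0 PE] := lattice_polytope_hull P.
have [c cE] := lattice_count_poly R S0.
have c0 : c 0%N = 1.
  have := cE 0%N; rewrite -PE lattice_count0 big_nat_recl // expr0 scale1r => ->.
  by rewrite big1 ?addr0 // => i _; rewrite exprS mul0r scale0r.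
rewrite (steiner_coefficientE pE).
rewrite (@steiner_coefficientE _ (fun i => p i + c i.-1 *: int_mx rat b)).
  rewrite /= c0 scale1r map_mxD; congr (_ + _).
  by rewrite /int_mx -map_mx_comp; apply: eq_map_mx => x; rewrite /= ratr_int.
move=> k; rewrite int_mx_point_sum.
rewrite (@lattice_sum_reindex _ _ (dilate k P) _ (fun x => x + b *+ k)).
- under [RHS]eq_bigr do rewrite scalerDr.
  rewrite big_split -pE int_mx_point_sum !lattice_sum_fset.
  set v := int_mx rat (b *+ k).
  have hD x : (@int_mx rat n 1 \o (fun x => x + b *+ k)) x = int_mx rat x + v.
    by rewrite /= /v /int_mx map_mxD.
  rewrite (eq_bigr _ (fun x _ => hD x)) big_split; congr (_ + _).
  have := cE k; rewrite -PE lattice_sum_fset => sum1.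
  have -> : v = k%:R *: int_mx rat b by rewrite /v /int_mx raddfMn /= scaler_nat.
  rewrite -[k%:R *: _]scale1r -scaler_suml sum1 scaler_suml big_add1.
  by apply: eq_bigr => i _; rewrite !scalerA exprS /=; congr (_ *: _); rewrite mulrC -mulrA.
- by move=> x y /addIr.
apply/seteqP; split=> [x [_ [y Py <-] xE]|_ [x [y Py xE] <-]].
  exists (x - b *+ k); last by rewrite subrK.
  exists y => //; rewrite /int_mx raddfB raddfMn /= -/(int_mx R x) -xE scalerDr.
  by rewrite (scaler_nat k (map_mx _ b)) addrK.
exists (y + int_mx R b); first by exists y.
by rewrite scalerDr xE (scaler_nat k (int_mx R b)) /int_mx raddfD raddfMn.
Qed.

End Steiner.

(** * Equivariant functions on the standard simplices *)

Local Open Scope fset_scope.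
Local Open Scope ring_scope.

Lemma det_shear n (k l : 'I_n) : l != k -> \det (1%:M + delta_mx l k : 'M[int]_n) = 1.
Proof.
move=> lk; have diag1 (A : 'M[int]_n) : (forall r, A r r = 1) -> is_trig_mx A -> \det A = 1.
  by move=> A1 /det_trig ->; rewrite big1.
have diagE r : (1%:M + delta_mx l k : 'M[int]_n) r r = 1.
  rewrite !mxE eqxx; case: (r =P l) => [->|]; last by rewrite addr0.
  by rewrite (negPf lk) addr0.
have [ltkl|ltlk|/val_inj kl] := ltngtP k l; last by rewrite kl eqxx in lk.
  apply: diag1 => //; apply/is_trig_mxP => r s ltrs; rewrite !mxE.
  have [rs|_] := r =P s; first by rewrite rs ltnn in ltrs.
  case: (r =P l) => [rl|]//; case: (s =P k) => [sk|]//.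
  by move: ltrs; rewrite rl sk ltnNge (ltnW ltkl).
rewrite -det_tr; apply: diag1 => [r|]; first by rewrite mxE diagE.
apply/is_trig_mxP => r s ltrs; rewrite !mxE.
have [rs|_] := s =P r; first by rewrite rs ltnn in ltrs.
case: (s =P l) => [sl|]//; case: (r =P k) => [rk|]//.
by move: ltrs; rewrite sl rk ltnNge (ltnW ltlk).
Qed.

Section ThreeCycle.
Variables (n d : nat) (i j : 'I_n).
Hypotheses (lt_id : (i < d)%N) (lt_jd : (j < d)%N) (ij : i != j).

(** The linear part of the affine map that permutes cyclically the vertices 0, e_i
    and e_j of the standard d-simplex and fixes the other ones. *)
Definition cycle_mx (K : nzRingType) : 'M[K]_n := \matrix_(r, s)
  if r == i then - (s < d)%:R else if r == j then (s == i)%:R else (r == s)%:R.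

Lemma cycle_mxE (K : nzRingType) p (x : 'M[K]_(n, p)) r c :
  (cycle_mx K *m x) r c = if r == i then - \sum_(s < n | (s < d)%N) x s c
    else if r == j then x i c else x r c.
Proof.
rewrite mxE; under eq_bigr do rewrite mxE.
case: eqVneq => _; [|case: eqVneq => _].
- rewrite -sumrN [RHS]big_mkcond; apply: eq_bigr => s _.
  by case: ifP => _; rewrite ?mulN1r // oppr0 mul0r.
- rewrite (bigD1 i) //= eqxx mul1r big1 ?addr0 // => s /negPf ->.
  by rewrite mul0r.
- rewrite (bigD1 r) //= eqxx mul1r big1 ?addr0 // => s; rewrite eq_sym => /negPf ->.
  by rewrite mul0r.
Qed.

Lemma cycle_mx_sum (K : nzRingType) p (x : 'M[K]_(n, p)) c :
  \sum_(s < n | (s < d)%N) (cycle_mx K *m x) s c = - x j c.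
Proof.
have sumE (y : 'M[K]_(n, p)) : \sum_(s < n | (s < d)%N) y s c =
    y i c + y j c + \sum_(s < n | (s < d)%N && (s != i) && (s != j)) y s c.
  rewrite (bigD1 i) //= (bigD1 j) /= ?addrA //.
  by rewrite lt_jd eq_sym.
rewrite sumE !cycle_mxE !eqxx eq_sym (negPf ij).
rewrite [X in _ + X = _](eq_bigr (fun s => x s c)); last first.
  by move=> s /andP[/andP[_ /negPf si] /negPf sj]; rewrite cycle_mxE si sj.
rewrite (sumE x) !opprD; set t := \sum_(_ < _ | _) _.
by rewrite addrAC addrNK addrAC addNr add0r.
Qed.

(** The cube of this matrix is 1, and 1 is the only integer whose cube is 1. *)
Lemma det_cycle_mx : \det (cycle_mx int) = 1.
Proof.
have M3 : cycle_mx int *m (cycle_mx int *m (cycle_mx int *m 1%:M)) = 1%:M.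
  apply/matrixP=> r c; rewrite cycle_mxE cycle_mx_sum.
  case: eqVneq => [->|ri].
    by rewrite opprK cycle_mxE eq_sym (negPf ij) eqxx.
  case: eqVneq => [->|rj]; first by rewrite cycle_mxE eqxx cycle_mx_sum opprK.
  by rewrite !cycle_mxE (negPf ri) (negPf rj).
have := congr1 determinant M3; rewrite mulmx1 !det_mulmx det1 => e.
set D := \det _ in e *.
have : (`|D| * (`|D| * `|D|) = 1)%N by rewrite -!abszM e.
move=> /eqP; rewrite muln_eq1 => /andP[/eqP D1 _].
by case: D D1 e => [[|[|D]]|[|D]].
Qed.

End ThreeCycle.

Section StandardSimplex.
Variables (R : realType) (n : nat).
Hypothesis n_ge2 : (2 <= n)%N.
Notation pt := 'cV[int]_n.

(** Translations act trivially on the values: this is the behaviour of the difference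
    of two translation equivariant functions. *)
Definition affine_equivariant (W : {fset pt} -> 'cV[R]_n) :=
  forall (M : 'M[int]_n) (b : pt) (S : {fset pt}), \det M = 1 -> S != fset0 ->
    W [fset M *m x + b | x in S] = int_mx R M *m W S.

(** One formula for the origin (p = 0) and the basis vectors (1 <= p <= n), so that
    the vertices of the standard d-simplex are indexed by p <= d. *)
Definition std_vertex (p : nat) : pt := \col_(r < n) (r.+1 == p)%:R.
Definition std_simplex d : {fset pt} := vertex_set (fun p : 'I_d.+1 => std_vertex p) predT.

Lemma std_simplexP d x :
  reflect (exists2 p, (p <= d)%N & x = std_vertex p) (x \in std_simplex d).
Proof.
apply: (iffP (vertex_setP _ _ _)) => [[p _ ->]|[p lepd ->]].
  by exists p; rewrite // -ltnS.
by exists (inord p); rewrite //= inordK.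
Qed.

Variable W : {fset pt} -> 'cV[R]_n.
Hypothesis Weq : affine_equivariant W.

Lemma std_simplex_fixed d (M : 'M[int]_n) b : \det M = 1 ->
  (forall p, (p <= d)%N -> exists2 q, (q <= d)%N & M *m std_vertex p + b = std_vertex q) ->
  int_mx R M *m W (std_simplex d) = W (std_simplex d).
Proof.
move=> detM Mstd; rewrite -(Weq b) //; last first.
  by apply/fset0Pn; exists (std_vertex 0); apply/std_simplexP; exists 0%N.
congr W; apply/eqP; rewrite eqEfcard; apply/andP; split.
  apply/fsubsetP=> _ /imfsetP[_ /= /std_simplexP[p lepd ->] ->].
  by have [q leqd ->] := Mstd p lepd; apply/std_simplexP; exists q.
rewrite [X in (_ <= X)%N]card_imfset //= => x y /addIr/(can_inj (mulKmx _)); apply.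
by rewrite unitmxE detM unitr1.
Qed.

(** A shear adding the k-th coordinate to another one fixes the simplex for k >= d,
    so the k-th coordinate of the value v is 0.  For d >= 2 the 3-cycles show that
    the first d coordinates of v are all equal and that each of them is the opposite
    of their sum.  For d = 1 a reflection in two coordinates exchanges the two
    vertices. *)
Lemma std_simplex_zero d : (d <= n)%N -> W (std_simplex d) = 0.
Proof.
move=> ledn; set v := W _.
have v_high (k : 'I_n) : (d <= k)%N -> v k 0 = 0.
  move=> ledk; have [l lk] : exists l : 'I_n, l != k.
    have [k0|k0] := eqVneq (k : nat) 0%N.
      by exists (Ordinal n_ge2); rewrite -val_eqE /= k0.
    by exists (Ordinal (ltnW n_ge2)); rewrite -val_eqE /= eq_sym.
  have Mx (K : nzRingType) (x : 'cV[K]_n) r :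
      ((1%:M + delta_mx l k) *m x) r 0 = x r 0 + (r == l)%:R * x k 0.
    rewrite mulmxDl mul1mx !mxE (bigD1 k) //= mxE eqxx andbT big1 ?addr0 // => s /negPf sk.
    by rewrite mxE sk andbF mul0r.
  have := @std_simplex_fixed d (1%:M + delta_mx l k) 0 (det_shear lk).
  rewrite -/v => /(_ _)/matrixP/(_ l 0).
  rewrite /int_mx map_mxD map_mx1 map_delta_mx Mx eqxx mul1r => fixl.
  apply: (addrI (v l 0)); rewrite addr0; apply: fixl => p lepd; exists p => //.
  apply/colP=> r; rewrite addr0 Mx !mxE [k.+1 == p]gtn_eqF ?mulr0 ?addr0 //.
  by rewrite ltnS (leq_trans lepd).
apply/colP=> i; rewrite mxE.
have [lt_id|] := ltnP i d; last exact: v_high.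
have [d1|d_neq1] := eqVneq d 1%N.
  have i0 : i = 0%N :> nat by move: lt_id; rewrite d1; case: (i : nat).
  pose l : 'I_n := Ordinal n_ge2.
  have li : l != i by rewrite -val_eqE /= i0.
  pose D (K : nzRingType) : 'rV[K]_n := \row_r if (r == i) || (r == l) then -1 else 1.
  have := @std_simplex_fixed d (diag_mx (D int)) (std_vertex 1).
  rewrite -/v => /(_ _ _)/matrixP/(_ i 0).
  have -> : int_mx R (diag_mx (D int)) = diag_mx (D R).
    rewrite /int_mx map_diag_mx; congr diag_mx; apply/rowP=> r; rewrite !mxE.
    by case: ifP => _; rewrite ?rmorphN1 ?rmorph1.
  rewrite mul_diag_mx !mxE eqxx /= mulN1r => fixi.
  suff : - v i 0 = v i 0 by lra.
  apply: fixi => [|p].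
    rewrite det_diag (bigD1 i) //= (bigD1 l) //= !mxE !eqxx orbT /= mulrA mulN1r opprK mul1r.
    by rewrite big1 // => r /andP[/negPf ri /negPf rl]; rewrite mxE ri rl.
  rewrite d1 => lep1; exists (1 - p)%N; first by rewrite leq_subr.
  apply/colP=> r; rewrite mul_diag_mx !mxE.
  have [->|ri] := eqVneq r i; first by rewrite ?eqxx i0; case: p lep1 => [|[|]].
  have r0 : r.+1 == 1%N = false.
    by apply/negbTE; rewrite eqSS -i0 val_eqE.
  case: p lep1 => [|[|]] //= _; rewrite ?r0 /=; case: ifP => _;
    by rewrite ?mulr0 ?mulr1 ?addr0.
have cyc (j : 'I_n) : (j < d)%N -> i != j ->
    int_mx R (cycle_mx d i j int) *m v = v.
  move=> lt_jd ij; apply: (@std_simplex_fixed d _ (std_vertex i.+1)) => [|p lepd].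
    exact: det_cycle_mx.
  have sum_std : \sum_(s < n | (s < d)%N) std_vertex p s 0 = (p != 0%N)%:R.
    case: p lepd => [|p] ltpd /=.
      by rewrite big1 // => s _; rewrite mxE.
    have ltpn : (p < n)%N by apply: leq_trans ltpd ledn.
    rewrite (bigD1 (Ordinal ltpn)) //= mxE eqxx big1 ?addr0 // => s /andP[_ sp].
    by rewrite mxE eqSS; case: eqP => // sp'; case/eqP: sp; apply: val_inj.
  pose q := if p == 0%N then i.+1 else if p == i.+1 then j.+1
            else if p == j.+1 then 0%N else p.
  exists q; first by rewrite /q; do 3!case: ifP => _ //.
  have ji : j != i by rewrite eq_sym.
  apply/colP=> r; rewrite mxE cycle_mxE sum_std !mxE /q.
  have simp := (eqSS, val_eqE, eqxx, negPf ij, negPf ji, oppr0, addNr, add0r, addr0).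
  have [->|p0] := eqVneq p 0%N;
    [|have [->|pi] := eqVneq p i.+1; [|have [->|pj] := eqVneq p j.+1]];
  (have [->|ri] := eqVneq r i; [|have [->|rj] := eqVneq r j]);
  rewrite /= ?simp ?(negPf ri) ?(negPf rj) ?simp //.
    by rewrite eq_sym (negPf pi).
  by rewrite [_ == p]eq_sym (negPf pj).
have cycE (j : 'I_n) : int_mx R (cycle_mx d i j int) = cycle_mx d i j R.
  apply/matrixP=> r s; rewrite !mxE.
  by do !case: ifP => _; rewrite ?rmorphN ?rmorph_nat.
have v_eq (j : 'I_n) : (j < d)%N -> v j 0 = v i 0.
  move=> lt_jd; have [->//|ji] := eqVneq j i.
  have := cyc j lt_jd; rewrite eq_sym => /(_ ji)/matrixP/(_ j 0).
  by rewrite cycE cycle_mxE (negPf ji) eqxx.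
have [j [lt_jd ij]] : exists j : 'I_n, (j < d)%N /\ i != j.
  have [i0|i0] := eqVneq (i : nat) 0%N.
    exists (Ordinal n_ge2); rewrite -val_eqE /= i0; split=> //; lia.
  exists (Ordinal (ltnW n_ge2)); rewrite -val_eqE /=; split=> //; lia.
have := cyc j lt_jd ij => /matrixP/(_ i 0).
rewrite cycE cycle_mxE eqxx (eq_bigr (fun=> v i 0)) => [|s]; last exact: v_eq.
rewrite sumr_const -mulr_natr; set c := _%:R => e.
have c_ge0 : 0 <= c by [].
have : (c + 1) * v i 0 = 0 by rewrite mulrDl mul1r -{2}e mulrC subrr.
by move/eqP; rewrite mulf_eq0 gt_eqF ?ltr_wpDl //= => /eqP.
Qed.

End StandardSimplex.

(** * Saturated simplices are unimodular images of standard ones *)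

Lemma saturated_dvd n m (f : 'I_m -> 'cV[int]_n) (N : int) c u : saturated f ->
  N *: u = \sum_i c i *: homog (f i) -> forall i, (N %| c i)%Z.
Proof.
move=> sat_f Nu i; have [N0|N_neq0] := eqVneq N 0.
  by rewrite (saturated_free sat_f (c := c)) ?dvdz0 // -Nu N0 scale0r.
have : (`|N|%N %| c i)%Z.
  apply: (sat_f _ _ (Num.sg N *: u)); first by rewrite absz_gt0.
  by rewrite -Nu -scaler_nat scalerA natz abszE mulrC -numEsg.
by rewrite !dvdzE.
Qed.

(** The edge vectors at the first vertex are, up to unimodular changes of basis on both
    sides, the multiples s_i e_i of basis vectors given by the Smith normal form.  By
    saturation s_i divides a whole column of a unimodular matrix, so it is a unit. *)
Lemma saturated_unimodular r d (f : 'I_d.+1 -> 'cV[int]_(d + r)) : saturated f ->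
  exists2 U : 'M[int]_(d + r), U \in unitmx &
    forall i : 'I_d, f (lift ord0 i) - f ord0 = col (lshift r i) U.
Proof.
move=> sat_f; pose Y := \matrix_(k, i) (f (lift ord0 i) - f ord0) k 0 : 'M[int]_(d + r, d).
have [L L_unit [Q Q_unit [s _ YE]]] := int_Smith_normal_form Y.
set D := \matrix_(_, _) _ in YE.
have s_unit (i : 'I_d) : s`_i \is a GRing.unit.
  have dvd_s (j : 'I_d) : (s`_i %| invmx Q j i)%Z.
    pose c (p : 'I_d.+1) := if unlift ord0 p is Some j then invmx Q j i
                            else - \sum_j invmx Q j i.
    have c0 : c ord0 = - \sum_j invmx Q j i by rewrite /c unlift_none.
    have cS k : c (lift ord0 k) = invmx Q k i by rewrite /c liftK.
    rewrite -cS; apply: (saturated_dvd (u := col_mx 0 (col (lshift r i) L)) sat_f).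
    have -> : \sum_p c p *: homog (f p) =
        col_mx 0 (\sum_k invmx Q k i *: (f (lift ord0 k) - f ord0)).
      rewrite affine_comb !big_ord_recl c0 (eq_bigr _ (fun k _ => cS k)) addNr.
      have cSf k : c (lift ord0 k) *: f (lift ord0 k) = invmx Q k i *: f (lift ord0 k).
        by rewrite cS.
      rewrite (eq_bigr _ (fun k _ => cSf k)); congr (col_mx _ _).
      under [RHS]eq_bigr do rewrite scalerBr.
      by rewrite sumrB -scaler_suml scaleNr addrC.
    rewrite scale_col_mx scaler0; congr (col_mx _ _).
    have /(congr1 (fun A => col i (A *m invmx Q))) := YE.
    rewrite mulmxK // => YQ.
    have -> : \sum_j invmx Q j i *: (f (lift ord0 j) - f ord0) = col i (Y *m invmx Q).
      apply/colP=> k; rewrite !mxE summxE; apply: eq_bigr => j' _.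
      by rewrite !mxE mulrC.
    rewrite YQ; apply/colP=> k; rewrite !mxE (bigD1 (lshift r i)) //= mxE eqxx mulr1n.
    rewrite mulrC big1 ?addr0 // => k' k'i; rewrite mxE.
    suff /negPf -> : (k' : nat) != i by rewrite mulr0n mulr0.
    by apply: contraNneq k'i => k'i; apply/eqP/val_inj.
  have QQ : \sum_j Q i j * invmx Q j i = 1.
    by have /matrixP/(_ i i) := mulmxV Q_unit; rewrite mxE [RHS]mxE eqxx.
  have : (s`_i %| \sum_j Q i j * invmx Q j i)%Z.
    by apply: rpred_sum => j _; apply: dvdz_mull.
  by rewrite QQ dvdz1; case: (s`_i) => [[|[]]|[]].
pose U := L *m block_mx (diag_mx (\row_i s`_(i : 'I_d)) *m Q) 0 0 1%:M.
exists U.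
  rewrite unitmxE /U det_mulmx det_ublock det_mulmx det_diag det1 mulr1 !unitrM.
  rewrite -!unitmxE L_unit Q_unit andbT /=.
  by rewrite rpred_prod // => i _; rewrite mxE s_unit.
move=> i.
have DE : D = col_mx (diag_mx (\row_i s`_(i : 'I_d))) 0.
  apply/matrixP=> k j; rewrite mxE; case: (split_ordP k) => k' ->.
    by rewrite col_mxEu !mxE.
  rewrite col_mxEd mxE /= [(_ == _)%N]gtn_eqF ?mulr0n //.
  by rewrite (leq_trans (ltn_ord j)) ?leq_addr.
have : col i Y = col (lshift r i) U.
  rewrite YE DE /U !colE -!mulmxA; congr (_ *m _).
  have -> : delta_mx (lshift r i) 0 = col_mx (delta_mx i 0) 0 :> 'cV[int]_(d + r).
    apply/colP=> k; rewrite mxE; case: (split_ordP k) => k' ->.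
      by rewrite col_mxEu mxE (inj_eq (@lshift_inj _ _)).
    by rewrite col_mxEd mxE eq_rlshift.
  by rewrite mul_col_mx mul_block_col !mul0mx !mulmx0 !addr0 mulmxA.
by move=> <-; apply/colP=> k; rewrite !mxE.
Qed.

Lemma saturated_std n d (f : 'I_d.+1 -> 'cV[int]_n) : saturated f ->
  exists2 U : 'M[int]_n, U \in unitmx &
    forall i : 'I_d.+1, f i = U *m std_vertex n i + f ord0.
Proof.
move=> sat_f; have le_dn := saturated_dim sat_f; rewrite add1n ltnS in le_dn.
move: sat_f; rewrite -(subnKC le_dn) in f * => sat_f.
have [U U_unit UE] := saturated_unimodular sat_f; exists U => // i.
case: (unliftP ord0 i) => [j|] ->; last first.
  rewrite (_ : std_vertex _ _ = 0) ?mulmx0 ?add0r //.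
  by apply/colP=> r; rewrite !mxE.
apply/eqP; rewrite -subr_eq; apply/eqP; rewrite UE; apply/colP=> k.
rewrite !mxE (bigD1 (lshift _ j)) //= mxE eqxx mulr1 big1 ?addr0 // => l lj.
rewrite mxE /= /bump /= add1n eqSS; suff /negPf -> : (l : nat) != j by rewrite mulr0.
by apply: contraNneq lj => lj; apply/eqP/val_inj.
Qed.

Section Uniqueness.
Variables (R : realType) (n : nat).
Hypothesis n_ge2 : (2 <= n)%N.

(** Conjugating W by the unimodular map U, whose determinant may be -1, gives again an
    equivariant function, to which the vanishing on standard simplices applies. *)
Lemma affine_equivariant_saturated (W : {fset 'cV[int]_n} -> 'cV[R]_n) d
    (f : 'I_d.+1 -> 'cV[int]_n) :
  affine_equivariant W -> saturated f -> W (vertex_set f predT) = 0.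
Proof.
move=> Weq sat_f; have [U U_unit fE] := saturated_std sat_f.
have le_dn := saturated_dim sat_f; rewrite add1n ltnS in le_dn.
pose phi (x : 'cV[int]_n) : 'cV[int]_n := U *m x + f ord0.
pose V (S : {fset 'cV[int]_n}) := int_mx R (invmx U) *m W [fset phi x | x in S].
have UR : int_mx R U *m int_mx R (invmx U) = 1%:M.
  by rewrite -map_mxM mulmxV // /int_mx map_mx1.
have Veq : affine_equivariant V.
  move=> M b S detM S0; rewrite /V.
  have -> : [fset phi x | x in [fset M *m x + b | x in S]] =
      [fset (U *m M *m invmx U) *m y + (U *m b + f ord0 - U *m M *m invmx U *m f ord0)
         | y in [fset phi x | x in S]].
    rewrite -!imfset_comp; apply: eq_imfset => //= x.
    rewrite /phi /= !mulmxDr !mulmxA mulmxKV //.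
    by rewrite [_ - U *m M *m invmx U *m f ord0]addrC addrA addrK addrA.
  rewrite Weq; last by case/fset0Pn: S0 => x Sx;
    apply/fset0Pn; exists (phi x); apply: in_imfset.
    by rewrite !mulmxA /int_mx -!map_mxM !mulmxA mulVmx // mul1mx.
  by rewrite !det_mulmx detM mulr1 -det_mulmx mulmxV // det1.
have := std_simplex_zero n_ge2 Veq le_dn; rewrite /V.
have -> : [fset phi x | x in std_simplex n d] = vertex_set f predT.
  apply/fsetP=> x; apply/imfsetP/vertex_setP => [[_ /= /vertex_setP[i _ ->] ->]|[i _ ->]].
    by exists i; rewrite // fE.
  by exists (std_vertex n i); [apply: (mem_vertex_set (fun p : 'I_d.+1 => _)) | rewrite fE].
move/(congr1 (mulmx (int_mx R U))); rewrite mulmxA UR mul1mx mulmx0.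
by [].
Qed.

End Uniqueness.

(** * Characterization of the discrete Steiner point *)

Local Open Scope classical_set_scope.
Local Open Scope ring_scope.

Section HullPolytope.
Variables (R : realType) (n : nat).
Implicit Types (S : {fset 'cV[int]_n}).

Lemma real_hull_lattice S :
  is_lattice_polytope (real_hull R (if S == fset0 then [fset 0] else S)).
Proof.
exists [set` if S == fset0 then [fset 0] else S]; split; [exact: finite_fset| |by []].
case: eqVneq => [_|/fset0Pn[x Sx]]; last by exists x.
by exists 0; rewrite /= in_fset1.
Qed.

(** The hull of the empty set is not a polytope; the origin is a dummy value there. *)
Definition hull_polytope S : latticePolytope R n := LatticePolytope (real_hull_lattice S).

Lemma hull_polytopeE S : S != fset0 -> hull_polytope S = real_hull R S :> set 'cV[R]_n.
Proof. by move=> /negPf S0; rewrite /= S0. Qed.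

Lemma real_hull_affine (M : 'M[int]_n) (b : 'cV[int]_n) S :
  real_hull R [fset M *m x + b | x in S] =
  [set int_mx R M *m x + int_mx R b | x in real_hull R S].
Proof.
rewrite /real_hull convex_hull_affine; congr convex_hull.
have MbE x : int_mx R (M *m x + b) = int_mx R M *m int_mx R x + int_mx R b.
  by rewrite /int_mx map_mxD map_mxM.
apply/seteqP; split=> [_ [_ /imfsetP[x /= Sx ->] <-]|_ [_ [x Sx <-] <-]].
  by exists (int_mx R x) => //; exists x.
by exists (M *m x + b) => //; apply: in_imfset.
Qed.

End HullPolytope.

Theorem theorem5 (R : realType) (n : nat) (hn : (2 <= n)%N)
    (z : latticePolytope R n -> 'cV[R]_n) :
  [/\ valuation z, SL_equivariant z & translation_equivariant z] <->
  z = @discrete_steiner R n.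
Proof.
split=> [[z_val z_SL z_tr]|->]; last first.
  split; [exact: discrete_steiner_valuation|exact: discrete_steiner_SL|].
  exact: discrete_steiner_translation.
pose W (S : {fset 'cV[int]_n}) :=
  z (hull_polytope R S) - discrete_steiner (hull_polytope R S).
have W_cut : cut_relation W.
  move=> S a q j k v v0 Sv; have [SU SI] := real_hull_cut R v0 Sv.
  have S0 : S != fset0.
    by apply: contraNneq v0 => S0; rewrite S0 in Sv; apply/eqP/in_cone_nil.
  have aS0 (c : 'cV[int]_n) T : (c |` T)%fset != fset0.
    by apply/fset0Pn; exists c; apply: fset1U1.
  have UE : hull_polytope R (a |` (q |` S))%fset =
      hull_polytope R (a |` S)%fset `|` hull_polytope R (q |` S)%fset :> set 'cV[R]_n.
    by rewrite !hull_polytopeE.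
  have IE : hull_polytope R S =
      hull_polytope R (a |` S)%fset `&` hull_polytope R (q |` S)%fset :> set 'cV[R]_n.
    by rewrite !hull_polytopeE.
  have [/(_ _ IE) zE _] := z_val _ _ _ UE.
  have [/(_ _ IE) sE _] := @discrete_steiner_valuation R n _ _ _ UE.
  have subD (u u' v1 v1' t t' i i' : 'cV[R]_n) : u + v1 = t + i -> u' + v1' = t' + i' ->
      (u - u') + (v1 - v1') = (t - t') + (i - i').
    by move=> e e'; rewrite addrACA -opprD e e' opprD addrACA.
  exact: subD zE sE.
have W_eq : affine_equivariant W.
  move=> M b S detM S0; have hullE : hull_polytope R [fset M *m x + b | x in S] =
      lp_shift (lp_lin M (hull_polytope R S)) b.
    apply: lp_set_inj; rewrite hull_polytopeE; last first.
      by case/fset0Pn: S0 => x Sx; apply/fset0Pn; exists (M *m x + b); apply: in_imfset.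
    rewrite real_hull_affine -hull_polytopeE //=.
    by rewrite image_comp.
  rewrite /W hullE z_tr z_SL // discrete_steiner_translation discrete_steiner_SL //.
  by rewrite opprD addrACA subrr addr0 mulmxBr.
apply/funext => P; have [S S0 PE] := lattice_polytope_hull P.
have -> : P = hull_polytope R S by apply: lp_set_inj; rewrite hull_polytopeE.
apply/eqP; rewrite -subr_eq0; apply/eqP.
apply: (saturated_reduction W_cut (X := fun v => v = 0) _ _ _ S0) => //.
  by move=> u v -> ->; rewrite subr0.
by move=> d f; apply: affine_equivariant_saturated.
Qed.
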